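(* Let $\mathbb{K}\in\{\mathbb{Z},\mathbb{Q},\mathbb{R}\}$. The following formulas define an action of the quantum group $\mathbf{U}_\upsilon(\mathfrak{sl}(\mathbb{K}))$ on $\mathcal{F}_{\mathbb{K}}=\bigoplus_{p\in\mathsf{Pyr}(\mathbb{K})}\widetilde{\mathbb{Q}}\,|p\rangle$: for any $\mathbb{K}$-interval $J=[a,b[$ and any $p\in\mathsf{Pyr}(\mathbb{K})$, $$E_J|p\rangle=\begin{cases}-\upsilon^{1/2}(-\upsilon)^{p(b)-p(a)}\,|p-\mathbf 1_J\rangle & \text{if } J \text{ is a removable interval of } p,\\ 0&\text{otherwise,}\end{cases}$$ $$F_J|p\rangle=\begin{cases}\upsilon^{1/2}(-\upsilon)^{p(a)-p(b)}\,|p+\mathbf 1_J\rangle & \text{if } J \text{ is an addable interval of } p,\\ 0&\text{otherwise,}\end{cases}$$ $$K_J|p\rangle=\upsilon^{n_J(p)}|p\rangle,$$ where $n_J(p)=0$ if $J$ is neither addable to nor removable from $p$, $n_J(p)=1$ if $J$ is addable to $p$, and $n_J(p)=-1$ if $J$ is removable from $p$. The representation $\mathcal{F}_{\mathbb{K}}$ is highest weight and irreducible.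
   Context: Ground ring: $\widetilde{\mathbb{Q}}=\mathbb{Q}[\upsilon,\upsilon^{-1}]$. Step functions. $\mathbb{F}(\mathbb{K})$ is the set of right-continuous piecewise constant functions $f:\mathbb{R}\to\mathbb{Z}$ with bounded support and finitely many discontinuities, all in $\mathbb{K}$. A $\mathbb{K}$-interval is $J=[a,b[=\{x\in\mathbb{R}: a\le x<b\}$ with $a<b$, $a,b\in\mathbb{K}$; $\mathbf 1_J$ is its characteristic function and $\overline J$ its closure. For $h\in\mathbb{F}(\mathbb{K})$ put $h_\pm(x)=\lim_{t\to0,\,t>0}h(x\pm t)$. For $f,g\in\mathbb{F}(\mathbb{K})$ put $\langle f,g\rangle=\sum_x f_-(x)(g_-(x)-g_+(x))$ and $(f,g)=\langle f,g\rangle+\langle g,f\rangle$. Pyramids. A $\mathbb{K}$-pyramid is a function $p\in\mathbb{F}(\mathbb{K})$ with values in $\mathbb{N}=\{0,1,2,\dots\}$ such that $p(0)=\max p$, $p$ is weakly increasing on $x\le 0$ and weakly decreasing on $x\ge 0$, and $|p_+(x)-p_-(x)|\le 1$ for all $x$. (For $\mathbb{K}=\mathbb{Z}$ this is the same as a function on $\mathbb{Z}$, extended to be constant on each $[n,n+1[$.) $\mathsf{Pyr}(\mathbb{K})$ is the set of $\mathbb{K}$-pyramids. A $\mathbb{K}$-interval $J$ is addable to (resp. removable from) $p$ if $p+\mathbf 1_J$ (resp. $p-\mathbf 1_J$) is again a $\mathbb{K}$-pyramid; no interval is both addable to and removable from the same $p$. The quantum group. $\mathbf{U}_\upsilon(\mathfrak{sl}(\mathbb{K}))$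 is the topological $\widetilde{\mathbb{Q}}$-bialgebra generated by $E_J,F_J,K_J^{\pm1}$ ($J$ running over all $\mathbb{K}$-intervals) with the relations: (1) for all intervals: $[K_{I_1},K_{I_2}]=0$, $K_IE_JK_I^{-1}=\upsilon^{(\mathbf 1_I,\mathbf 1_J)}E_J$, $K_IF_JK_I^{-1}=\upsilon^{-(\mathbf 1_I,\mathbf 1_J)}F_J$; $[F_{J_1},E_{J_2}]=0$ if $J_1\cap J_2=\emptyset$; $[E_J,F_J]=\frac{K_J-K_J^{-1}}{\upsilon-\upsilon^{-1}}$. (2) (join) for $J_1=[a,b[$, $J_2=[b,c[$: $K_{J_1}K_{J_2}=K_{J_1\cup J_2}$, $E_{J_1\cup J_2}=\upsilon^{1/2}E_{J_1}E_{J_2}-\upsilon^{-1/2}E_{J_2}E_{J_1}$, $F_{J_1\cup J_2}=\upsilon^{-1/2}F_{J_2}F_{J_1}-\upsilon^{1/2}F_{J_1}F_{J_2}$. (3) (nest) if $\overline{J_1}\cap\overline{J_2}=\emptyset$: $[E_{J_1},E_{J_2}]=0$ and $[F_{J_1},F_{J_2}]=0$; if $J_1\subseteq J_2$: $\upsilon^{\langle\mathbf 1_{J_1},\mathbf 1_{J_2}\rangle}E_{J_1}E_{J_2}=\upsilon^{\langle\mathbf 1_{J_2},\mathbf 1_{J_1}\rangle}E_{J_2}E_{J_1}$ and $\upsilon^{\langle\mathbf 1_{J_1},\mathbf 1_{J_2}\rangle}F_{J_1}F_{J_2}=\upsilon^{\langle\mathbf 1_{J_2},\mathbf 1_{J_1}\rangle}F_{J_2}F_{J_1}$.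 Here $K_JK_J^{-1}=K_J^{-1}K_J=1$. (The topological coproduct carried by this bialgebra plays no role in the statement: an action means a module structure over the algebra.) A highest weight representation is one generated by a vector that is annihilated by all $E_J$ and is a common eigenvector of all $K_J$.
   Formalization: The ground ring is enlarged by υ^{1/2}, which the formulas need, and irreducibility is stated over the fraction field Q(υ^{1/2}), since over Laurent polynomials (υ−1)F_K is a proper nonzero submodule; action and highest weight are stated over both. *)

(* Defs.v *)
From HB Require Import structures.
From mathcomp Require Import all_boot all_order all_algebra.
From mathcomp Require Import generic_quotient.
(* monalg provides [malg I R], the free R-module on I; its notations clash with
   those of mathcomp-analysis. *)
From mathcomp Require Import -(notations) monalg.
From mathcomp Require Import all_classical all_reals all_analysis.

Set Implicit Arguments.
Unset Strict Implicit.
Unset Printing Implicit Defensive.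
Import Order.TTheory GRing.Theory Num.Theory.
Import numFieldNormedType.Exports.
Local Open Scope classical_set_scope.
Local Open Scope ring_scope.

(* The formulas involve [upsilon^(1/2)], so the ring of Laurent polynomials in
   upsilon has to be enlarged to [Q[upsilon^(1/2), upsilon^(-1/2)]].  Below,
   [q] always stands for [upsilon^(1/2)]. *)

Notation ratfrac := {fraction {poly rat}}.
Definition qF : ratfrac := FracField.tofrac ('X : {poly rat}).

Definition is_laurent : {pred ratfrac} :=
  fun x => `[< exists (n : nat) (p : {poly rat}),
                 x * qF ^+ n = FracField.tofrac p >].

Fact is_laurent_subring : subring_closed is_laurent.
Proof.
split.
- by apply/asboolP; exists 0%N, 1; rewrite expr0 mulr1 rmorph1.
- move=> x y /asboolP[m [p xp]] /asboolP[n [r yr]]; apply/asboolP.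
  exists (m + n)%N, (p * 'X^n - r * 'X^m).
  rewrite rmorphB !rmorphM !rmorphXn /= -/qF -xp -yr mulrBl exprD.
  by congr (_ - _); rewrite -!mulrA // [qF ^+ m * _]mulrC.
- move=> x y /asboolP[m [p xp]] /asboolP[n [r yr]]; apply/asboolP.
  by exists (m + n)%N, (p * r); rewrite rmorphM /= -xp -yr exprD mulrACA.
Qed.

HB.instance Definition _ :=
  GRing.isSubringClosed.Build ratfrac is_laurent is_laurent_subring.

Record laurent := Laurent { laurent_val : ratfrac; _ : laurent_val \in is_laurent }.

HB.instance Definition _ := [isSub for laurent_val].
HB.instance Definition _ := [Choice of laurent by <:].
HB.instance Definition _ := [SubChoice_isSubComNzRing of laurent by <:].

Definition laurent_unit : {pred laurent} :=
  fun x => (val x != 0) && ((val x)^-1 \in is_laurent).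
Definition laurent_inv (x : laurent) : laurent :=
  if laurent_unit x then insubd x (val x)^-1 else x.

Fact laurent_mulVx : {in laurent_unit, left_inverse 1 laurent_inv *%R}.
Proof.
move=> x xU; have /andP[x0 xV] := xU; apply: val_inj.
rewrite /laurent_inv; have -> : laurent_unit x by [].
by rewrite rmorphM [X in X * _]insubdK //= mulVf.
Qed.
Fact laurent_unitPl (x y : laurent) : y * x = 1 -> laurent_unit x.
Proof.
move=> /(congr1 val); rewrite rmorphM rmorph1 /= => yx.
have x0 : laurent_val x != 0.
  by apply: contra_eq_neq yx => ->; rewrite mulr0 eq_sym oner_neq0.
rewrite /laurent_unit /= x0 -[_^-1]mul1r -yx mulfK //=.
by case: (y) => ? /=.
Qed.
Fact laurent_invr_out : {in [predC laurent_unit], laurent_inv =1 id}.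
Proof. by move=> x; rewrite inE /laurent_inv => /negbTE xN; rewrite ifF. Qed.

HB.instance Definition _ := GRing.ComNzRing_hasMulInverse.Build laurent
  laurent_mulVx laurent_unitPl laurent_invr_out.

Fact qF_laurent : qF \in is_laurent.
Proof. by apply/asboolP; exists 0%N, 'X; rewrite expr0 mulr1. Qed.
Definition qL : laurent := Laurent qF_laurent.

Fact qL_unit : qL \is a GRing.unit.
Proof.
have qF0 : qF != 0 by rewrite /qF tofrac_eq0 polyX_eq0.
apply/andP; split => //; apply/asboolP; exists 1%N, 1.
by rewrite expr1 mulVf // rmorph1.
Qed.

(* Continuity and limits of functions R -> int refer to the discrete topology,
   which the library has on [nat] but not on [int]. *)
HB.instance Definition _ := hasNbhs.Build int principal_filter.
HB.instance Definition _ := Discrete_ofNbhs.Build int erefl.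
HB.instance Definition _ := isPointed.Build int 0.

Section StepFunctions.
Variables (R : realType) (K : set R).

(* An integer valued function is locally constant wherever it is continuous, so
   with finitely many discontinuities it is piecewise constant. *)
Definition step_function (f : R -> int) : Prop :=
  let disc := [set x : R | ~ continuous_at x f] in
  [/\ forall x : R, f @ x^'+ --> f x,
      bounded_set [set x | f x != 0],
      finite_set disc
    & disc `<=` K].

Definition rlim (h : R -> int) (x : R) : int := lim (h @ x^'+).
Definition llim (h : R -> int) (x : R) : int := lim (h @ x^'-).

Definition euler (f g : R -> int) : int :=
  \sum_(x \in [set: R]) llim f x * (llim g x - rlim g x).
Definition sym_euler (f g : R -> int) : int := euler f g + euler g f.

Record kinterval := KInterval {
  lo : R;
  hi : R;
  _ : K lo;
  _ : K hi;
  _ : lo < hi }.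

Definition ico (J : kinterval) : set R := [set` `[lo J, hi J[].

Definition chi (J : kinterval) : R -> int := \1_(ico J).

Definition is_pyramid (p : R -> int) : Prop :=
  [/\ step_function p,
      forall x, 0 <= p x,
      forall x, p x <= p 0,
      (forall x y, x <= y -> y <= 0 -> p x <= p y)
        /\ (forall x y, 0 <= x -> x <= y -> p y <= p x)
    & forall x, `|rlim p x - llim p x| <= 1].

Record pyramid := Pyramid { pyr :> R -> int; _ : is_pyramid pyr }.

HB.instance Definition _ := gen_eqMixin pyramid.
HB.instance Definition _ := gen_choiceMixin pyramid.

Definition addable (J : kinterval) (p : pyramid) : Prop :=
  is_pyramid (fun x => p x + chi J x).
Definition removable (J : kinterval) (p : pyramid) : Prop :=
  is_pyramid (fun x => p x - chi J x).

Definition nJ (J : kinterval) (p : pyramid) : int :=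
  if `[< addable J p >] then 1 else if `[< removable J p >] then -1 else 0.

End StepFunctions.

(* The algebra is presented by generators and relations: it is the quotient of
   the formal expressions [qterm] by the smallest congruence [qeq] that contains
   the axioms of associative unital algebras and the defining relations [qrel]. *)

Section QuantumGroup.
Variables (A : comUnitRingType) (q : A) (R : realType) (K : set R).

Local Notation itv := (kinterval K).

Inductive qterm : Type :=
  | QE of itv | QF of itv | QK of itv | QKinv of itv
  | Q0 | Q1
  | Qopp of qterm
  | Qadd of qterm & qterm
  | Qmul of qterm & qterm
  | Qscale of A & qterm.

HB.instance Definition _ := gen_eqMixin qterm.
HB.instance Definition _ := gen_choiceMixin qterm.

Declare Scope qterm_scope.
Delimit Scope qterm_scope with Q.
Bind Scope qterm_scope with qterm.
Notation "x + y" := (Qadd x y) : qterm_scope.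
Notation "- x" := (Qopp x) : qterm_scope.
Notation "x - y" := (Qadd x (Qopp y)) : qterm_scope.
Notation "x * y" := (Qmul x y) : qterm_scope.
Notation "c *: x" := (Qscale c x) : qterm_scope.
Notation "0" := Q0 : qterm_scope.
Notation "1" := Q1 : qterm_scope.

Definition qcomm (x y : qterm) : qterm := (x * y - y * x)%Q.

Local Notation v := (q ^+ 2).
Local Notation euler_itv I J := (euler (chi I) (chi J)).
Local Notation sym_euler_itv I J := (sym_euler (chi I) (chi J)).
Local Notation "J1 <disjoint> J2" := (ico J1 `&` ico J2 = set0)
  (at level 70, no associativity).
Local Notation "J1 <apart> J2" := (closure (ico J1) `&` closure (ico J2) = set0)
  (at level 70, no associativity).

(* [J1 = [a, b[], [J2 = [b, c[] and [J] is their union [[a, c[]. *)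
Definition joins (J1 J2 J : itv) : Prop :=
  hi J1 = lo J2 /\ ico J = ico J1 `|` ico J2.

Inductive qrel : qterm -> qterm -> Prop :=
  | QrelKV J : qrel (QK J * QKinv J) 1
  | QrelVK J : qrel (QKinv J * QK J) 1
  | QrelKK I1 I2 : qrel (qcomm (QK I1) (QK I2)) 0
  | QrelKE I J :
      qrel (QK I * QE J * QKinv I) (v ^ (sym_euler_itv I J) *: QE J)
  | QrelKF I J :
      qrel (QK I * QF J * QKinv I) (v ^ (- sym_euler_itv I J) *: QF J)
  | QrelFE_disjoint J1 J2 : J1 <disjoint> J2 ->
      qrel (qcomm (QF J1) (QE J2)) 0
  (* The denominator [v - v^-1] is not invertible in Laurent polynomials, so it
     is multiplied out. *)
  | QrelEF J :
      qrel ((v - v^-1)%R *: qcomm (QE J) (QF J)) (QK J - QKinv J)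
  | QrelK_join J1 J2 J : joins J1 J2 J ->
      qrel (QK J1 * QK J2) (QK J)
  | QrelE_join J1 J2 J : joins J1 J2 J ->
      qrel (QE J) (q *: (QE J1 * QE J2) - q^-1 *: (QE J2 * QE J1))
  | QrelF_join J1 J2 J : joins J1 J2 J ->
      qrel (QF J) (q^-1 *: (QF J2 * QF J1) - q *: (QF J1 * QF J2))
  | QrelE_apart J1 J2 : J1 <apart> J2 -> qrel (qcomm (QE J1) (QE J2)) 0
  | QrelF_apart J1 J2 : J1 <apart> J2 -> qrel (qcomm (QF J1) (QF J2)) 0
  | QrelE_nest J1 J2 : ico J1 `<=` ico J2 ->
      qrel (v ^ (euler_itv J1 J2) *: (QE J1 * QE J2))
           (v ^ (euler_itv J2 J1) *: (QE J2 * QE J1))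
  | QrelF_nest J1 J2 : ico J1 `<=` ico J2 ->
      qrel (v ^ (euler_itv J1 J2) *: (QF J1 * QF J2))
           (v ^ (euler_itv J2 J1) *: (QF J2 * QF J1)).

Inductive qeq : qterm -> qterm -> Prop :=
  | Qeq_rel x y : qrel x y -> qeq x y
  | Qeq_refl x : qeq x x
  | Qeq_sym x y : qeq x y -> qeq y x
  | Qeq_trans x y z : qeq x y -> qeq y z -> qeq x z
  | Qeq_opp x x' : qeq x x' -> qeq (- x) (- x')
  | Qeq_add x x' y y' : qeq x x' -> qeq y y' -> qeq (x + y) (x' + y')
  | Qeq_mul x x' y y' : qeq x x' -> qeq y y' -> qeq (x * y) (x' * y')
  | Qeq_scale c x x' : qeq x x' -> qeq (c *: x) (c *: x')
  | Qeq_addA x y z : qeq (x + (y + z)) (x + y + z)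
  | Qeq_addC x y : qeq (x + y) (y + x)
  | Qeq_add0 x : qeq (0 + x) x
  | Qeq_addN x : qeq (- x + x) 0
  | Qeq_mulA x y z : qeq (x * (y * z)) (x * y * z)
  | Qeq_mul1x x : qeq (1 * x) x
  | Qeq_mulx1 x : qeq (x * 1) x
  | Qeq_mulDl x y z : qeq ((x + y) * z) (x * z + y * z)
  | Qeq_mulDr x y z : qeq (x * (y + z)) (x * y + x * z)
  | Qeq_scaleA c d x : qeq (c *: (d *: x)) ((c * d)%R *: x)
  | Qeq_scale1 x : qeq (1%R *: x) x
  | Qeq_scaleDr c x y : qeq (c *: (x + y)) (c *: x + c *: y)
  | Qeq_scaleDl c d x : qeq ((c + d)%R *: x) (c *: x + d *: x)
  | Qeq_scaleAl c x y : qeq (c *: (x * y)) (c *: x * y)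
  | Qeq_scaleAr c x y : qeq (c *: (x * y)) (x * (c *: y)).

(* The counit, used to see that the quotient is a nontrivial ring. *)
Fixpoint qcounit (x : qterm) : A :=
  match x with
  | QE _ | QF _ => 0
  | QK _ | QKinv _ => 1
  | Q0 => 0
  | Q1 => 1
  | Qopp x => - qcounit x
  | Qadd x y => qcounit x + qcounit y
  | Qmul x y => qcounit x * qcounit y
  | Qscale c x => c * qcounit x
  end.

Fact qcounit_eq x y : qeq x y -> qcounit x = qcounit y.
Proof.
elim=> {x y} /= [x y||||||||||||||||||||||].
- case=> *; rewrite /= ?(mulr0, mul0r, mulr1, mul1r, subrr, addr0, oppr0) //.
- by [].
- by move=> x y _ ->.
- by move=> x y z _ -> _ ->.
- by move=> x x' _ ->.
- by move=> x x' y y' _ -> _ ->.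
- by move=> x x' y y' _ -> _ ->.
- by move=> c x x' _ ->.
- by move=> *; rewrite addrA.
- by move=> *; rewrite addrC.
- by move=> *; rewrite add0r.
- by move=> *; rewrite addNr.
- by move=> *; rewrite mulrA.
- by move=> *; rewrite mul1r.
- by move=> *; rewrite mulr1.
- by move=> *; rewrite mulrDl.
- by move=> *; rewrite mulrDr.
- by move=> *; rewrite mulrA.
- by move=> *; rewrite mul1r.
- by move=> *; rewrite mulrDr.
- by move=> *; rewrite mulrDl.
- by move=> *; rewrite mulrA.
- by move=> *; rewrite mulrCA.
Qed.

Definition qeqb (x y : qterm) : bool := `[< qeq x y >].

Fact qeqb_refl : reflexive qeqb.
Proof. by move=> x; apply/asboolP; apply: Qeq_refl. Qed.
Fact qeqb_sym : symmetric qeqb.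
Proof. by move=> x y; apply/asboolP/asboolP; apply: Qeq_sym. Qed.
Fact qeqb_trans : transitive qeqb.
Proof.
by move=> y x z /asboolP xy /asboolP yz; apply/asboolP; apply: Qeq_trans yz.
Qed.
Canonical qeqb_equiv := EquivRel qeqb qeqb_refl qeqb_sym qeqb_trans.

Definition Uq : Type := {eq_quot qeqb}%qT.
HB.instance Definition _ := Choice.on Uq.
HB.instance Definition _ := EqQuotient.on Uq.

Definition qpi (x : qterm) : Uq := (\pi_Uq x)%qT.

Fact qpi_eq x y : qeq x y -> qpi x = qpi y.
Proof. by move=> xy; apply/eqquotP/asboolP. Qed.
Fact qpiE x y : qpi x = qpi y -> qeq x y.
Proof. by move=> /eqquotP/asboolP. Qed.
Fact qpi_repr (u : Uq) : qpi (repr u) = u.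
Proof. exact: reprK. Qed.
Fact repr_qpi x : qeq (repr (qpi x)) x.
Proof. by apply: qpiE; rewrite qpi_repr. Qed.

Definition Uq_opp (a : Uq) : Uq := qpi (- repr a)%Q.
Definition Uq_add (a b : Uq) : Uq := qpi (repr a + repr b)%Q.
Definition Uq_mul (a b : Uq) : Uq := qpi (repr a * repr b)%Q.
Definition Uq_scale (c : A) (a : Uq) : Uq := qpi (c *: repr a)%Q.

Fact qpi_opp x : qpi (- x)%Q = Uq_opp (qpi x).
Proof. by apply/qpi_eq/Qeq_opp/Qeq_sym/repr_qpi. Qed.
Fact qpi_add x y : qpi (x + y)%Q = Uq_add (qpi x) (qpi y).
Proof. by apply/qpi_eq/Qeq_add; apply/Qeq_sym/repr_qpi. Qed.
Fact qpi_mul x y : qpi (x * y)%Q = Uq_mul (qpi x) (qpi y).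
Proof. by apply/qpi_eq/Qeq_mul; apply/Qeq_sym/repr_qpi. Qed.
Fact qpi_scale c x : qpi (c *: x)%Q = Uq_scale c (qpi x).
Proof. by apply/qpi_eq/Qeq_scale/Qeq_sym/repr_qpi. Qed.

Let qpi_ops := (qpi_opp, qpi_add, qpi_mul, qpi_scale).

Fact Uq_addA : associative Uq_add.
Proof.
move=> a b c; rewrite -(qpi_repr a) -(qpi_repr b) -(qpi_repr c) -!qpi_ops.
exact/qpi_eq/Qeq_addA.
Qed.
Fact Uq_addC : commutative Uq_add.
Proof.
by move=> a b; rewrite -(qpi_repr a) -(qpi_repr b) -!qpi_ops; apply/qpi_eq/Qeq_addC.
Qed.
Fact Uq_add0 : left_id (qpi 0) Uq_add.
Proof. by move=> a; rewrite -(qpi_repr a) -!qpi_ops; apply/qpi_eq/Qeq_add0. Qed.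
Fact Uq_addN : left_inverse (qpi 0) Uq_opp Uq_add.
Proof. by move=> a; rewrite -(qpi_repr a) -!qpi_ops; apply/qpi_eq/Qeq_addN. Qed.

HB.instance Definition _ :=
  GRing.isZmodule.Build Uq Uq_addA Uq_addC Uq_add0 Uq_addN.

Fact Uq_mulA : associative Uq_mul.
Proof.
move=> a b c; rewrite -(qpi_repr a) -(qpi_repr b) -(qpi_repr c) -!qpi_ops.
exact/qpi_eq/Qeq_mulA.
Qed.
Fact Uq_mul1x : left_id (qpi 1) Uq_mul.
Proof. by move=> a; rewrite -(qpi_repr a) -!qpi_ops; apply/qpi_eq/Qeq_mul1x. Qed.
Fact Uq_mulx1 : right_id (qpi 1) Uq_mul.
Proof. by move=> a; rewrite -(qpi_repr a) -!qpi_ops; apply/qpi_eq/Qeq_mulx1. Qed.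
Fact Uq_mulDl : left_distributive Uq_mul Uq_add.
Proof.
move=> a b c; rewrite -(qpi_repr a) -(qpi_repr b) -(qpi_repr c) -!qpi_ops.
exact/qpi_eq/Qeq_mulDl.
Qed.
Fact Uq_mulDr : right_distributive Uq_mul Uq_add.
Proof.
move=> a b c; rewrite -(qpi_repr a) -(qpi_repr b) -(qpi_repr c) -!qpi_ops.
exact/qpi_eq/Qeq_mulDr.
Qed.
Fact Uq_oner_neq0 : qpi 1 != qpi 0.
Proof.
by apply/eqP => /qpiE/qcounit_eq /= /eqP; rewrite oner_eq0.
Qed.

HB.instance Definition _ := GRing.Zmodule_isNzRing.Build Uq
  Uq_mulA Uq_mul1x Uq_mulx1 Uq_mulDl Uq_mulDr Uq_oner_neq0.

Fact Uq_scaleA c d (a : Uq) : Uq_scale c (Uq_scale d a) = Uq_scale (c * d) a.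
Proof. by rewrite -(qpi_repr a) -!qpi_ops; apply/qpi_eq/Qeq_scaleA. Qed.
Fact Uq_scale1 : left_id 1 Uq_scale.
Proof. by move=> a; rewrite -(qpi_repr a) -!qpi_ops; apply/qpi_eq/Qeq_scale1. Qed.
Fact Uq_scaleDr : right_distributive Uq_scale +%R.
Proof.
move=> c a b; rewrite -(qpi_repr a) -(qpi_repr b) -[RHS]/(Uq_add _ _).
rewrite -[X in Uq_scale c X]/(Uq_add _ _) -!qpi_ops.
exact/qpi_eq/Qeq_scaleDr.
Qed.
Fact Uq_scaleDl (a : Uq) : {morph Uq_scale^~ a : c d / c + d}.
Proof.
move=> c d /=; rewrite -(qpi_repr a) -[RHS]/(Uq_add _ _) -!qpi_ops.
exact/qpi_eq/Qeq_scaleDl.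
Qed.

HB.instance Definition _ := GRing.Zmodule_isLmodule.Build A Uq
  Uq_scaleA Uq_scale1 Uq_scaleDr Uq_scaleDl.

Fact Uq_scaleAl c (a b : Uq) : c *: (a * b) = c *: a * b.
Proof.
rewrite -(qpi_repr a) -(qpi_repr b) -[LHS]/(Uq_scale c (Uq_mul _ _)).
rewrite -[RHS]/(Uq_mul (Uq_scale c _) _) -!qpi_ops.
exact/qpi_eq/Qeq_scaleAl.
Qed.
HB.instance Definition _ := GRing.Lmodule_isLalgebra.Build A Uq Uq_scaleAl.

Fact Uq_scaleAr c (a b : Uq) : c *: (a * b) = a * (c *: b).
Proof.
rewrite -(qpi_repr a) -(qpi_repr b) -[LHS]/(Uq_scale c (Uq_mul _ _)).
rewrite -[RHS]/(Uq_mul _ (Uq_scale c _)) -!qpi_ops.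
exact/qpi_eq/Qeq_scaleAr.
Qed.
HB.instance Definition _ := GRing.Lalgebra_isAlgebra.Build A Uq Uq_scaleAr.

Definition UE (J : itv) : Uq := qpi (QE J).
Definition UF (J : itv) : Uq := qpi (QF J).
Definition UK (J : itv) : Uq := qpi (QK J).

End QuantumGroup.

Section Modules.
Variables (A : comUnitRingType).

Definition is_module (U : algType A) (V : lmodType A) (act : U -> V -> V) : Prop :=
  [/\ forall a, linear (act a),
      forall x, linear (act^~ x),
      forall x, act 1 x = x
    & forall a b x, act (a * b) x = act a (act b x)].

(* Over a ring of scalars that is not a field this fails for a free module (take
   N = c V with c not invertible), so it is meant for fields. *)
Definition irreducible (U : algType A) (V : lmodType A) (act : U -> V -> V) : Prop :=
  (exists x : V, x != 0) /\
  forall N : {pred V},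
    GRing.submod_closed N ->
    (forall a x, x \in N -> act a x \in N) ->
    (forall x, x \in N -> x = 0) \/ (forall x, x \in N).

End Modules.

(* [fock_formulas] does not mention the inverse of [UK J], whose action is
   forced by that of [UK J]. *)

Section Fock.
Variables (A : comUnitRingType) (q : A) (R : realType) (K : set R).

Local Notation itv := (kinterval K).
Local Notation pyramid := (pyramid K).
Local Notation U := (Uq q K).
Local Notation v := (q ^+ 2).

Definition Fock : lmodType A := malg pyramid A.
Definition ket (p : pyramid) : Fock := mkmalgU p 1.

Definition fock_formulas (act : U -> Fock -> Fock) : Prop :=
  [/\ forall (J : itv) (p : pyramid),
        (forall rem : removable J p,
           act (UE q J) (ket p) =
             (- q * (- v) ^ (p (hi J) - p (lo J))) *: ket (Pyramid rem)) /\
        (~ removable J p -> act (UE q J) (ket p) = 0),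
      forall (J : itv) (p : pyramid),
        (forall add : addable J p,
           act (UF q J) (ket p) =
             (q * (- v) ^ (p (lo J) - p (hi J))) *: ket (Pyramid add)) /\
        (~ addable J p -> act (UF q J) (ket p) = 0)
    & forall (J : itv) (p : pyramid),
        act (UK q J) (ket p) = v ^ (nJ J p) *: ket p].

Definition fock_action (act : U -> Fock -> Fock) : Prop :=
  is_module act /\ fock_formulas act.

Definition highest_weight (act : U -> Fock -> Fock) : Prop :=
  exists x : Fock,
    [/\ x != 0,
        forall J : itv, act (UE q J) x = 0,
        forall J : itv, exists c : A, act (UK q J) x = c *: x
      & forall y : Fock, exists a : U, y = act a x].

End Fock.

(* Main.v *)
Require Import Defs.
From HB Require Import structures.
From mathcomp Require Import all_boot all_order all_algebra.
From mathcomp Require Import zify ring lra.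
From mathcomp Require Import finmap.
From mathcomp Require Import -(notations) monalg.
From mathcomp Require Import all_classical all_reals all_analysis.

(** A pyramid is a particle configuration in disguise.  Its jumps are 0 or 1 at
    points x <= 0 and 0 or -1 at points x > 0, so adding 1 to the jumps at x > 0
    gives an occupation number [occ p x] in {0, 1} at every real x (a Maya
    diagram), and conversely a step function with these occupation numbers is a
    pyramid ([pyramid_occ]).  Adding the characteristic function of J = [a, b[
    moves one particle from b to a: J is addable iff a is empty and b occupied,
    and removable iff a is occupied and b empty.  So [F_J] and [E_J] move one
    particle from b to a and back, up to a unit, and [n_J(p)] is the occupation
    of b minus that of a: F_K is the charge zero part of a semi-infinite wedge.

    Both families are instances of one operator [hop e J], e = 1 or -1, which
    sends |p> to e q (-v)^(e (p(a) - p(b))) |p + e 1_J>, where q is the square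
    root of v.  The defining relations reduce to three facts.  Two hops with
    disjoint sets of endpoints commute, because the possibility of each move does
    not depend on the other one, and the coefficients do not change either when
    the intervals are apart or strictly nested ([hop_comm]).  Two hops that both
    fill, or both empty, the same point compose to zero ([hop_clash]).  For
    [a, b[ and [b, c[, exactly one of the two compositions survives, according to
    the occupation of b, and its coefficient is the one of [a, c[ up to the
    factor prescribed by the join relation ([hop_join]).  The relations with K
    only say how a hop changes the occupation numbers.

    An action with the prescribed formulas is unique because all generators but
    the inverse of [K_J] are prescribed on a basis, and that inverse is forced.

    The vacuum is the zero pyramid.  Every pyramid of height n + 1 has a removable
    interval around 0, whose removal lowers the height to n
    ([removable_ex]).  Hence the [F_J] produce every |p> from the vacuum, up to a
    unit, which gives a highest weight representation over Laurent polynomials.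
    Conversely a product of [E_J] brings |p> down to the vacuum and kills every
    other |p'> whose height is at most that of p ([lowering]).  Over a field,
    applying it to a nonzero vector of a submodule, with p of maximal height in
    the support of that vector, shows that the submodule contains the vacuum,
    hence everything. *)

Set Implicit Arguments.
Unset Strict Implicit.
Unset Printing Implicit Defensive.
Import Order.TTheory GRing.Theory Num.Theory.
Import numFieldNormedType.Exports.
Local Open Scope classical_set_scope.
Local Open Scope ring_scope.

(** * Limits of integer valued functions *)

Section StepCalculus.
Variables (R : realType) (K : set R).
Implicit Types (f g : R -> int) (x y : R).

Lemma cvg_intP (T : Type) (F : set_system T) (f : T -> int) (l : int) :
  Filter F -> f @ F --> l <-> \forall t \near F, f t = l.
Proof. by move=> FF; rewrite discrete_cvg. Qed.

Lemma lim_int (T : Type) (F : set_system T) (f : T -> int) (l : int) :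
  ProperFilter F -> f @ F --> l -> lim (f @ F) = l.
Proof. by move=> FF; apply: cvg_lim; exact: discrete_hausdorff. Qed.

Lemma near_left_ex (P : set R) x : (\forall z \near x^'-, P z) ->
  exists2 y, y < x & forall z, y < z -> z < x -> P z.
Proof.
move=> /nbhs_ballP[e e0 eP]; exists (x - e) => [|z yz zx].
  by rewrite ltrBlDr ltrDl.
apply: eP => //; rewrite /ball /= gtr0_norm ?subr_gt0 //; lra.
Qed.

Lemma near_right_ex (P : set R) x : (\forall z \near x^'+, P z) ->
  exists2 y, x < y & forall z, x < z -> z < y -> P z.
Proof.
move=> /nbhs_ballP[e e0 eP]; exists (x + e) => [|z yz zx].
  by rewrite ltrDl.
apply: eP => //; rewrite /ball /= ltr0_norm ?subr_lt0 //; lra.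
Qed.

(** Left limits exist for pyramids by monotonicity alone; keeping their existence
    as a separate property, stable under adding intervals, avoids deriving it from
    the finiteness of the set of discontinuities. *)
Definition left_limits f := forall x, f @ x^'- --> llim f x.
Definition jump f x : int := f x - llim f x.
(** The occupation number of the site x: the vacuum, with no jump at all, has the
    sites x > 0 occupied and the sites x <= 0 empty. *)
Definition occ f x : int := jump f x + (0 < x)%R%:Z.

Lemma llimP f x (l : int) : f @ x^'- --> l -> llim f x = l.
Proof. exact: lim_int. Qed.

Lemma rlimE f x : right_continuous f -> rlim f x = f x.
Proof. by move=> fr; exact: lim_int (fr x). Qed.

Lemma left_limitsP f :
  (forall x, exists l : int, f @ x^'- --> l) -> left_limits f.
Proof. by move=> fl x; have [l lP] := fl x; rewrite (llimP lP). Qed.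

Lemma discontinuityP f x : right_continuous f -> left_limits f ->
  ~ continuous_at x f <-> jump f x != 0.
Proof.
move=> fr fl; rewrite /continuous_at -left_right_continuousP subr_eq0 eq_sym.
split=> [H|/eqP H [L _]].
- by apply/eqP => e; apply: H; split => //; rewrite -[X in _ --> X]e; apply: fl.
- by apply: H; apply: llimP.
Qed.

(** Real induction: the points z such that f x is a lower bound of f on [x, z]
    have a supremum, which belongs to them because the jump there is nonnegative,
    and which can only be y because f is constant on the right of it. *)
Lemma jump_ge0_le f x y : right_continuous f -> left_limits f -> x <= y ->
  (forall z, x < z -> z <= y -> 0 <= jump f z) -> f x <= f y.
Proof.
move=> fr fl xy Hj.
pose T := [set z | x <= z <= y /\ forall w, x <= w <= z -> f x <= f w].
have Tx : T x by split=> [|w]; [rewrite lexx | rewrite -eq_le => /eqP <-].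
have uT : has_ubound T by exists y => z [/andP[]].
pose s := sup T.
have xs : x <= s by apply: ub_le_sup.
have sy : s <= y by apply: ge_sup; [exists x | move=> z [/andP[]]].
have below w : x <= w -> w < s -> f x <= f w.
  move=> xw ws; have sw0 : 0 < s - w by rewrite subr_gt0.
  have hsT : has_sup T by split=> //; exists x.
  have [z [_ zP]] := sup_adherent sw0 hsT.
  by rewrite -/s subKr => wz; apply: zP; rewrite xw ltW.
have Ts : T s.
  split=> [|w /andP[xw]]; first by rewrite xs.
  rewrite le_eqVlt => /orP[/eqP ->|]; last exact: below.
  have [<-//|{}xs] : x = s \/ x < s.
    by move: xs; rewrite le_eqVlt => /orP[/eqP|]; tauto.
  have /(cvg_intP _ _ _ ) /near_left_ex[u us uP] := fl s.
  have [v [uv xv vs]] : exists v, [/\ u < v, x <= v & v < s].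
    exists (Num.max x ((u + s) / 2)); rewrite lt_max le_max gt_max lexx xs /=.
    by split=> //; [apply/orP; right|]; lra.
  have := Hj s xs sy; have := below v xv vs.
  by rewrite (uP v uv vs) /jump; lia.
suff -> : y = s by case: Ts => _; apply; rewrite xs lexx.
apply/eqP; rewrite eq_le sy andbT leNgt; apply/negP => sy'.
have /(cvg_intP _ _ _ ) /near_right_ex[u us uP] := fr s.
pose m := Num.min y ((u + s) / 2).
have sm : s < m by rewrite lt_min sy' /=; lra.
have mu : m < u by rewrite gt_min; apply/orP; right; lra.
suff /(ub_le_sup uT) : T m by rewrite leNgt sm.
split=> [|w /andP[xw wm]].
  by rewrite (le_trans xs (ltW sm)) ge_min lexx.
have [ws|sw] := leP w s; first by case: Ts => _; apply; rewrite xw.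
rewrite (uP w sw (le_lt_trans wm mu)).
by case: Ts => _; apply; rewrite xs lexx.
Qed.

Lemma left_limitsN f : left_limits f -> left_limits (fun x => - f x) /\
  forall x, llim (fun x => - f x) x = - llim f x.
Proof.
move=> fl; have H x : (fun x => - f x) @ x^'- --> - llim f x.
  by apply/cvg_intP; have /cvg_intP := fl x; apply: filterS => z ->.
by split=> x; [rewrite (llimP (H x)) | exact: llimP].
Qed.

Lemma jump_le0_ge f x y : right_continuous f -> left_limits f -> x <= y ->
  (forall z, x < z -> z <= y -> jump f z <= 0) -> f y <= f x.
Proof.
move=> fr fl xy Hj; rewrite -lerN2.
have [fl' E] := left_limitsN fl.
apply: (@jump_ge0_le (fun x => - f x)) => // [z|z xz zy].
  by apply/cvg_intP; have /cvg_intP := fr z; apply: filterS => w ->.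
by have := Hj z xz zy; rewrite /jump E; lia.
Qed.

Lemma step_vanish f : step_function K f ->
  exists2 M : R, 0 < M & forall x, M < `|x| -> f x = 0.
Proof.
case=> _ /pinfty_ex_gt0[M M0 MP] _ _; exists M => // x Mx.
apply/eqP/contraT => fx; have : `|x| <= M := MP x fx.
by rewrite leNgt Mx.
Qed.

(** A nonincreasing function with values in the natural numbers is constant from
    the point where it takes its least value on. *)
Lemma nonincr_left_limit f d x : d < x ->
  (forall y z, d < y -> y <= z -> z < x -> f z <= f y) ->
  (forall y, d < y -> y < x -> 0 <= f y) ->
  exists l : int, f @ x^'- --> l.
Proof.
move=> dx fdec f0.
(* the values taken by f on ]d, x[; their minimum is the left limit *)
pose P := fun n : nat => `[< exists y, [/\ d < y, y < x & f y = n%:Z] >].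
have exP : exists n, P n.
  have h : d < (d + x) / 2 /\ (d + x) / 2 < x by split; lra.
  have := f0 _ h.1 h.2; case E : (f _) => [n|//] _.
  by exists n; apply/asboolP; exists ((d + x) / 2); rewrite E; case: h.
case: (ex_minnP exP) => n /asboolP[y [dy yx fy]] nmin; exists (f y).
apply/cvg_intP; near=> z.
have yz : y < z by near: z; apply: nbhs_left_gt.
have zx : z < x by near: z; apply: nbhs_left_lt.
have := f0 z (lt_trans dy yz) zx; have := fdec y z dy (ltW yz) zx.
case E : (f z) => [m|//]; rewrite fy => mn _.
have /nmin : P m by apply/asboolP; exists z; rewrite E.
lia.
Unshelve. all: by end_near.
Qed.

Lemma pyramid_right_continuous f : is_pyramid K f -> right_continuous f.
Proof. by case=> [[]]. Qed.

(** On x <= 0 the height defect f 0 - f x is nonincreasing, on x > 0 the height f x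
    itself is. *)
Lemma pyramid_left_limits f : is_pyramid K f -> left_limits f.
Proof.
case=> _ f0 fmax [finc fdec] _; apply: left_limitsP => x.
have [x0|x0] := leP x 0; last first.
  apply: (nonincr_left_limit x0) => // y z y0 yz _.
  by apply: fdec => //; apply: ltW.
have [|y z _ yz zx|y _ _|l lP] := @nonincr_left_limit (fun y => f 0 - f y) (x - 1) x.
- lra.
- by rewrite lerB // finc // (le_trans (ltW zx)).
- by rewrite subr_ge0.
exists (f 0 - l); apply/cvg_intP; move/cvg_intP: lP; apply: filterS => z /= <-.
by rewrite subKr.
Qed.

(** * Pyramids as particle configurations *)

(** The sign of the jumps is equivalent to monotonicity on each side of 0 by real
    induction, and nonnegativity follows by starting from a point outside the
    bounded support. *)
Lemma pyramid_occ f : step_function K f -> left_limits f ->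
  is_pyramid K f <-> forall x, 0 <= occ f x <= 1.
Proof.
move=> fstep fl; have fr : right_continuous f by case: fstep.
have pick_left d x : d < x -> exists z, [/\ d < z, z < x & f z = llim f x].
  move=> dx; have /(cvg_intP _ _ _ ) /near_left_ex[u us uP] := fl x.
  have h : [/\ d < Num.max ((d + x) / 2) ((u + x) / 2),
               u < Num.max ((d + x) / 2) ((u + x) / 2)
             & Num.max ((d + x) / 2) ((u + x) / 2) < x].
    rewrite !lt_max gt_max.
    by split; [apply/orP; left|apply/orP; right|apply/andP; split]; lra.
  by case: h => h1 h2 h3; eexists; split; [exact: h1|exact: h3|exact: uP].
split=> [[_ f0 fmax [finc fdec] fj] x|Hocc].
  have := fj x; rewrite rlimE // /occ /jump; have [x0|x0] := leP x 0 => /=.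
    have [|z [_ zx <-]] := @pick_left (x - 1) x; first lra.
    by have := finc z x (ltW zx) x0; lia.
  have [z [z0 zx <-]] := pick_left 0 x x0.
  by have := fdec z x (ltW z0) (ltW zx); lia.
have finc x y : x <= y -> y <= 0 -> f x <= f y.
  move=> xy y0; apply: jump_ge0_le => // z _ zy; have := Hocc z; rewrite /occ.
  have -> : (0 < z) = false by apply: le_gtF; exact: le_trans zy y0.
  by rewrite addr0 => /andP[].
have fdec x y : 0 <= x -> x <= y -> f y <= f x.
  move=> x0 xy; apply: jump_le0_ge => // z xz _; have := Hocc z; rewrite /occ.
  have -> : 0 < z by exact: le_lt_trans xz.
  by move=> /andP[_]; rewrite /= -lerBrDr subrr.
have [M M0 MP] := step_vanish fstep.
have f0 x : 0 <= f x.
  have [x0|x0] := leP x 0.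
    have h : Num.min x (- (M + 1)) <= x by rewrite ge_min lexx.
    rewrite -(MP (Num.min x (- (M + 1)))) ?finc //.
    rewrite ler0_norm; last by rewrite ge_min x0.
    by rewrite ltrNr gt_min; apply/orP; right; lra.
  have h : x <= Num.max x (M + 1) by rewrite le_max lexx.
  rewrite -(MP (Num.max x (M + 1))) ?fdec ?(ltW x0) //.
  rewrite ger0_norm; last by rewrite le_max (ltW x0).
  by rewrite lt_max; apply/orP; right; lra.
split=> // x.
- by have [x0|/ltW x0] := leP x 0; [apply: finc|apply: fdec].
- by have := Hocc x; rewrite rlimE // /occ /jump; case: (0 < x) => /=; lia.
Qed.

(** * Adding and removing intervals *)

Lemma chiE (J : kinterval K) x : chi J x = ((lo J <= x) && (x < hi J))%:Z.
Proof. by rewrite /chi indicE natz /ico mem_setE in_itv. Qed.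

Lemma lo_lt_hi (J : kinterval K) : lo J < hi J. Proof. by case: J. Qed.

Lemma chi_right_continuous (J : kinterval K) : right_continuous (chi J).
Proof.
move=> x; apply/cvg_intP; rewrite chiE.
have [lx|xl] := leP (lo J) x; last first.
  by near=> z; rewrite chiE lt_geF //; near: z; apply: nbhs_right_lt.
have [hx|xh] := leP (hi J) x; near=> z; rewrite chiE.
  have xz : x < z by near: z; apply: nbhs_right_gt.
  by rewrite [z < _]le_gtF ?andbF // (le_trans hx (ltW xz)).
have xz : x < z by near: z; apply: nbhs_right_gt.
have -> : z < hi J by near: z; apply: nbhs_right_lt.
by rewrite (le_trans lx (ltW xz)).
Unshelve. all: by end_near.
Qed.

Lemma chi_left_cvg (J : kinterval K) x :
  chi J @ x^'- --> ((lo J < x) && (x <= hi J))%:Z.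
Proof.
apply/cvg_intP.
have [xl|lx] := leP x (lo J).
  near=> z; rewrite chiE lt_geF //.
  by have : z < x by [near: z; apply: nbhs_left_lt]; move/lt_le_trans; apply.
have [xh|hx] := leP x (hi J); near=> z; rewrite chiE.
  have zx : z < x by near: z; apply: nbhs_left_lt.
  have -> : lo J <= z by near: z; apply: nbhs_left_ge.
  by rewrite (lt_le_trans zx xh).
have hz : hi J <= z by near: z; apply: nbhs_left_ge.
by rewrite [z < _]le_gtF ?andbF.
Unshelve. all: by end_near.
Qed.

Lemma llim_chi (J : kinterval K) x :
  llim (chi J) x = ((lo J < x) && (x <= hi J))%:Z.
Proof. exact/llimP/chi_left_cvg. Qed.

Definition add_chi (e : int) (J : kinterval K) f : R -> int :=
  fun x => f x + e * chi J x.

(** The jump function of the characteristic function of J (see [jump_chi]); adding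
    [e] times the interval changes the occupation numbers by [e * dchi J]. *)
Definition dchi (J : kinterval K) x : int :=
  (x == lo J)%:Z - (x == hi J)%:Z.

Lemma add_chi_left_cvg e J f x : left_limits f ->
  add_chi e J f @ x^'- --> llim f x + e * llim (chi J) x.
Proof.
move=> fl; apply/cvg_intP; have /cvg_intP := fl x.
have /cvg_intP := chi_left_cvg (J := J) (x := x); rewrite -llim_chi.
by apply: filterS2 => z; rewrite /add_chi => -> ->.
Qed.

Lemma add_chi_left_limits e J f : left_limits f -> left_limits (add_chi e J f).
Proof.
move=> fl; apply: left_limitsP => x; eexists; exact: add_chi_left_cvg.
Qed.

Lemma jump_add_chi e J f x : left_limits f ->
  jump (add_chi e J f) x = jump f x + e * dchi J x.
Proof.
move=> fl; rewrite /jump (llimP (add_chi_left_cvg (e := e) (J := J) (x := x) fl)).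
rewrite /add_chi llim_chi chiE /dchi; have lh := lo_lt_hi J.
by case: (ltgtP x (lo J)) => xl; case: (ltgtP x (hi J)) => xh /=;
  lia || (exfalso; lra).
Qed.

Lemma occ_add_chi e J f x : left_limits f ->
  occ (add_chi e J f) x = occ f x + e * dchi J x.
Proof. by move=> fl; rewrite /occ jump_add_chi // addrAC. Qed.

Lemma add_chi_step e J f : left_limits f -> step_function K f ->
  step_function K (add_chi e J f).
Proof.
move=> fl fstep; have [M M0 MP] := step_vanish fstep.
case: fstep => fr _ fin finK.
have sr : right_continuous (add_chi e J f).
  move=> x; apply/cvg_intP; have /cvg_intP := fr x.
  have /cvg_intP := chi_right_continuous (J := J) (x := x).
  by apply: filterS2 => z; rewrite /add_chi => -> ->.
have sl := add_chi_left_limits (e := e) (J := J) fl.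
have sub : [set x | ~ continuous_at x (add_chi e J f)] `<=`
    [set x | ~ continuous_at x f] `|` [set lo J; hi J].
  move=> x /= /(discontinuityP x sr sl); rewrite jump_add_chi // => nz.
  have [->|xl] := eqVneq x (lo J); first by right; left.
  have [->|xh] := eqVneq x (hi J); first by right; right.
  left; apply/(discontinuityP x fr fl).
  by move: nz; rewrite /dchi (negbTE xl) (negbTE xh) mulr0 addr0.
split=> //.
- pose N := Num.max M (Num.max `|lo J| `|hi J|).
  apply: filterS (nbhs_pinfty_ge (num_real N)) => L NL x /= nz.
  apply: le_trans NL; move: nz.
  apply: contra_neqT; rewrite -ltNge !gt_max => /andP[Mx /andP[lx hx]].
  rewrite /add_chi MP // add0r chiE.
  case: (boolP (_ && _)) => [/andP[l h]|_]; last by rewrite mulr0.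
  exfalso; have [x0|x0] := leP 0 x.
    move: hx; rewrite (ger0_norm x0) gtr0_norm ?(le_lt_trans x0 h) //; lra.
  move: lx; rewrite (ltr0_norm x0) ltr0_norm ?(le_lt_trans l x0) //; lra.
- apply: sub_finite_set sub _; rewrite finite_setU; split=> //.
- apply: subset_trans sub _; rewrite subUset; split=> // x /= [] ->.
  + by case: (J).
  + by case: (J).
Qed.

Lemma add_chi_pyramid e J f : is_pyramid K f ->
  is_pyramid K (add_chi e J f) <-> forall x, 0 <= occ f x + e * dchi J x <= 1.
Proof.
move=> fP; have fl := pyramid_left_limits fP.
rewrite pyramid_occ; last exact: add_chi_left_limits.
  by split=> H x; have := H x; rewrite occ_add_chi.
by apply: add_chi_step => //; case: fP.
Qed.

Lemma dchi_lo (J : kinterval K) : dchi J (lo J) = 1.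
Proof. by rewrite /dchi eqxx lt_eqF ?lo_lt_hi. Qed.

Lemma dchi_hi (J : kinterval K) : dchi J (hi J) = -1.
Proof. by rewrite /dchi eqxx gt_eqF ?lo_lt_hi. Qed.

Lemma dchi_out (J : kinterval K) x :
  x != lo J -> x != hi J -> dchi J x = 0.
Proof. by rewrite /dchi => /negbTE -> /negbTE ->. Qed.

Lemma pyramid_occ_range f x : is_pyramid K f -> 0 <= occ f x <= 1.
Proof.
move=> fP; apply: (pyramid_occ _ (pyramid_left_limits fP)).1 => //.
by case: fP.
Qed.

Lemma add_chiC e e' J J' f :
  add_chi e J (add_chi e' J' f) = add_chi e' J' (add_chi e J f).
Proof. by apply/funext => x; rewrite /add_chi addrAC. Qed.

Lemma add_chiK e J f : add_chi (- e) J (add_chi e J f) = f.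
Proof. by apply/funext => x; rewrite /add_chi mulNr addrK. Qed.

Lemma add_chi_pyramidE e J f : `|e| = 1 -> is_pyramid K f ->
  is_pyramid K (add_chi e J f) <->
    occ f (lo J) = (e == -1)%:Z /\ occ f (hi J) = (e == 1)%:Z.
Proof.
move=> e1 fP; rewrite add_chi_pyramid //; have fo x := pyramid_occ_range x fP.
have ee : e = 1 \/ e = -1 by lia.
split=> [H|[l h] x].
  have := H (lo J); have := H (hi J); rewrite dchi_lo dchi_hi.
  by have := fo (lo J); have := fo (hi J); case: ee => ->; split => /=; lia.
have [->|xl] := eqVneq x (lo J); first by rewrite dchi_lo l; case: ee => ->.
have [->|xh] := eqVneq x (hi J); first by rewrite dchi_hi h; case: ee => ->.
by rewrite dchi_out // mulr0 addr0.
Qed.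

(** At a site that is not an endpoint of J the occupation numbers are those of the
    original pyramid, and at a site that is not an endpoint of J' they are those
    of the final one. *)
Lemma add_chi_swap e e' J J' f :
  (forall x, dchi J x = 0 \/ dchi J' x = 0) -> is_pyramid K f ->
  is_pyramid K (add_chi e J (add_chi e' J' f)) -> is_pyramid K (add_chi e J f).
Proof.
move=> JJ fP gP; apply/(add_chi_pyramid e J fP) => x.
have fl := pyramid_left_limits fP.
have := pyramid_occ_range x gP.
rewrite !occ_add_chi //; last exact: add_chi_left_limits.
case: (JJ x) => ->; rewrite !mulr0 !addr0 // => _; exact: pyramid_occ_range x fP.
Qed.

(** A site cannot be filled twice, nor emptied twice. *)
Lemma add_chi_clash e e' J J' f x : e * dchi J x = e' * dchi J' x ->
  e * dchi J x != 0 -> is_pyramid K f ->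
  ~ is_pyramid K (add_chi e J (add_chi e' J' f)).
Proof.
move=> ee nz fP gP; have fl := pyramid_left_limits fP.
have := pyramid_occ_range x gP; have := pyramid_occ_range x fP.
rewrite !occ_add_chi //; last exact: add_chi_left_limits.
by rewrite -ee; lia.
Qed.

Lemma addableE (p : pyramid K) J :
  addable J p <-> is_pyramid K (add_chi 1 J p).
Proof.
have -> // : add_chi 1 J p = fun x => p x + chi J x.
by apply/funext => x; rewrite /add_chi mul1r.
Qed.

Lemma removableE (p : pyramid K) J :
  removable J p <-> is_pyramid K (add_chi (-1) J p).
Proof.
have -> // : add_chi (-1) J p = fun x => p x - chi J x.
by apply/funext => x; rewrite /add_chi mulN1r.
Qed.

Lemma pyrP (p : pyramid K) : is_pyramid K p. Proof. by case: p. Qed.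

Lemma nJE (p : pyramid K) J : nJ J p = occ p (hi J) - occ p (lo J).
Proof.
rewrite /nJ; have := pyramid_occ_range (lo J) (pyrP p).
have := pyramid_occ_range (hi J) (pyrP p).
case: asboolP => [/addableE/(add_chi_pyramidE _ _ (pyrP p))|nadd].
  by case=> // -> ->.
case: asboolP => [/removableE/(add_chi_pyramidE _ _ (pyrP p))|nrem].
  by case=> // -> ->.
move=> h l; suff: ~ (occ p (lo J) = 0 /\ occ p (hi J) = 1) /\
  ~ (occ p (lo J) = 1 /\ occ p (hi J) = 0) by lia.
by split=> H; [apply: nadd; apply/addableE|apply: nrem; apply/removableE];
  apply/(add_chi_pyramidE _ _ (pyrP p)).
Qed.

Lemma zero_pyramid : is_pyramid K (fun=> 0).
Proof.
have c x (F : set_system R) : Filter F -> (fun=> 0 : int) @ F --> (0 : int).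
  by move=> FF; apply/cvg_intP; apply: nearW.
have fl : left_limits (fun=> 0) by apply: left_limitsP => x; exists 0; apply: c.
have l x : llim (fun=> 0) x = 0 by apply: llimP; apply: c.
split=> //; [|by move=> x; rewrite (rlimE (f := fun=> 0)) ?l // => ?; apply: c].
have d : [set x : R | ~ continuous_at x (fun=> 0 : int)] = set0.
  by rewrite -subset0 => x /=; apply; apply: c.
split=> [x||/=|/=]; [exact: c| |by rewrite d|by rewrite d].
by apply: filterS (nbhs_pinfty_ge (num_real 0))  => M _ x.
Qed.

Lemma pyramid_height0 f : is_pyramid K f -> f 0 <= 0 -> f = fun=> 0.
Proof.
case=> _ f0 fm _ _ f00; apply/funext => x; have := f0 x; have := fm x; lia.
Qed.

(** If all jumps at the points x <= 0 were nonpositive, then f 0 would be at most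
    the value 0 taken far on the left; so some a <= 0 carries an upward jump, and
    symmetrically some b > 0 carries a downward one. *)
Lemma removable_ex f : is_pyramid K f -> 0 < f 0 ->
  exists J : kinterval K,
    [/\ is_pyramid K (add_chi (-1) J f), lo J <= 0 & 0 < hi J].
Proof.
move=> fP f0; have fl := pyramid_left_limits fP.
have fr := pyramid_right_continuous fP.
have fstep : step_function K f by case: fP.
have [M M0 MP] := step_vanish fstep.
have fo x := pyramid_occ_range x fP.
have inK x : jump f x != 0 -> K x.
  by case: fstep => _ _ _ + /(discontinuityP x fr fl); apply.
have [a [a0 ja]] : exists a, a <= 0 /\ 0 < jump f a.
  apply: contrapT => H; have : f 0 <= f (- (M + 1)).
    apply: jump_le0_ge => // [|z _ z0]; first lra.
    by rewrite leNgt; apply/negP => jz; apply: H; exists z.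
  by rewrite (MP (- (M + 1))); [rewrite leNgt f0|rewrite ltr0_norm; lra].
have [b [b0 jb]] : exists b, 0 < b /\ jump f b < 0.
  apply: contrapT => H; have : f 0 <= f (M + 1).
    apply: jump_ge0_le => // [|z z0 _]; first lra.
    by rewrite leNgt; apply/negP => jz; apply: H; exists z.
  by rewrite (MP (M + 1)); [rewrite leNgt f0|rewrite gtr0_norm; lra].
have Ka : K a by apply: inK; rewrite gt_eqF.
have Kb : K b by apply: inK; rewrite lt_eqF.
exists (KInterval Ka Kb (le_lt_trans a0 b0)); split=> //.
apply/add_chi_pyramidE => //=; have := fo a; have := fo b.
by rewrite /occ b0 (le_gtF a0) /=; lia.
Qed.

(** * The Euler form and the position of intervals *)

Lemma jump_chi (J : kinterval K) x : jump (chi J) x = dchi J x.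
Proof.
have fl : left_limits (fun=> 0 : int) by exact: pyramid_left_limits zero_pyramid.
have -> : chi J = add_chi 1 J (fun=> 0).
  by apply/funext => z; rewrite /add_chi add0r mul1r.
rewrite jump_add_chi // mul1r /jump (@llimP _ _ 0) ?subr0 ?add0r //.
by apply/cvg_intP; exact: nearW.
Qed.

Lemma euler_chi (I J : kinterval K) : euler (chi I) (chi J) =
  ((lo I < hi J) && (hi J <= hi I))%:Z - ((lo I < lo J) && (lo J <= hi I))%:Z.
Proof.
have E x : llim (chi I) x * (llim (chi J) x - rlim (chi J) x) =
    - (((lo I < x) && (x <= hi I))%:Z * dchi J x).
  rewrite rlimE; last exact: chi_right_continuous.
  by rewrite -opprB -/(jump _ _) jump_chi llim_chi mulrN.
rewrite /euler; under eq_fsbigr do rewrite E.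
rewrite -(@fsbig_widen _ _ _ _ [set` [:: lo J; hi J]] setT) //; last first.
  move=> x [_ /=]; rewrite !inE => /negP; rewrite negb_or => /andP[xl xh].
  by rewrite dchi_out // mulr0 oppr0.
rewrite -fsbig_seq /=; last by rewrite inE lt_eqF // lo_lt_hi.
rewrite !big_cons big_nil dchi_lo dchi_hi; lia.
Qed.

(** The exponent in the relations between K and E, F is the change of the
    occupation difference along I caused by a move along J. *)
Lemma sym_euler_chi (I J : kinterval K) :
  sym_euler (chi I) (chi J) = dchi J (lo I) - dchi J (hi I).
Proof.
rewrite /sym_euler !euler_chi /dchi; have lI := lo_lt_hi I; have lJ := lo_lt_hi J.
case: (ltgtP (lo I) (lo J)) => h1; case: (ltgtP (lo I) (hi J)) => h2;
case: (ltgtP (hi I) (lo J)) => h3; case: (ltgtP (hi I) (hi J)) => h4 //=;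
exfalso; lra.
Qed.

Lemma icoE (J : kinterval K) x : ico J x = (lo J <= x < hi J) :> Prop.
Proof. by rewrite /ico /= in_itv. Qed.

Lemma subset_ico (I J : kinterval K) : ico I `<=` ico J ->
  lo J <= lo I /\ hi I <= hi J.
Proof.
move=> IJ; have lI := lo_lt_hi I; have := IJ (lo I); rewrite !icoE lexx lI.
move=> /(_ isT)/andP[ll lh]; split=> //; rewrite leNgt; apply/negP => hh.
have := IJ (Num.max (hi J) (lo I)); rewrite !icoE le_max lexx orbT gt_max hh lI.
by move=> /(_ isT)/andP[_]; rewrite gt_max ltxx.
Qed.

Lemma disjoint_ico (I J : kinterval K) : ico I `&` ico J = set0 ->
  hi I <= lo J \/ hi J <= lo I.
Proof.
move=> IJ; have [|h1] := leP (hi I) (lo J); first by left.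
have [|h2] := leP (hi J) (lo I); first by right.
have lI := lo_lt_hi I; have lJ := lo_lt_hi J.
suff : (ico I `&` ico J) (Num.max (lo I) (lo J)) by rewrite IJ.
by split; rewrite icoE le_max gt_max lexx ?orbT ?h1 ?h2 ?lI ?lJ.
Qed.

Lemma closure_ico (J : kinterval K) x : lo J <= x <= hi J -> closure (ico J) x.
Proof.
move=> /andP[l h]; have [xh|hx] := ltP x (hi J).
  by apply: subset_closure; rewrite icoE l.
have -> : x = hi J by apply/eqP; rewrite eq_le h.
move=> B /nbhs_ballP[e /= e0 eB]; have lh := lo_lt_hi J.
exists (Num.max (lo J) (hi J - e / 2)); split.
  by rewrite icoE le_max lexx gt_max lh /=; lra.
apply: eB; rewrite /ball /= ger0_norm.
  by rewrite ltrBlDr -ltrBlDl lt_max; apply/orP; right; lra.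
by rewrite subr_ge0 ge_max ltW //=; lra.
Qed.

Lemma apart_ico (I J : kinterval K) :
  closure (ico I) `&` closure (ico J) = set0 ->
  hi I < lo J \/ hi J < lo I.
Proof.
move=> IJ; have [|h1] := ltP (hi I) (lo J); first by left.
have [|h2] := ltP (hi J) (lo I); first by right.
have lI := ltW (lo_lt_hi I); have lJ := ltW (lo_lt_hi J).
suff : (closure (ico I) `&` closure (ico J)) (Num.max (lo I) (lo J)).
  by rewrite IJ.
by split; apply: closure_ico; rewrite le_max ge_max lexx ?orbT ?h1 ?h2 ?lI ?lJ.
Qed.

Lemma joins_ends (J1 J2 J : kinterval K) : joins J1 J2 J ->
  [/\ hi J1 = lo J2, lo J = lo J1 & hi J = hi J2].
Proof.
case=> h IJ; have l1 := lo_lt_hi J1; have l2 := lo_lt_hi J2; have l := lo_lt_hi J.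
have [a1 b1] : lo J <= lo J1 /\ hi J1 <= hi J.
  by apply: subset_ico; rewrite IJ; left.
have [a2 b2] : lo J <= lo J2 /\ hi J2 <= hi J.
  by apply: subset_ico; rewrite IJ; right.
have : ico J (lo J) by rewrite icoE lexx l.
rewrite IJ => /= e; have {}e : lo J1 <= lo J.
  by case: e; rewrite icoE => /andP[] //; lra.
split=> //; first by apply/eqP; rewrite eq_le a1 e.
apply/eqP; rewrite eq_le b2 andbT leNgt; apply/negP => hh.
have : ico J (hi J2) by rewrite icoE hh andbT; lra.
by rewrite IJ => -[]; rewrite icoE => /andP[]; lra.
Qed.

Lemma joins_chi (J1 J2 J : kinterval K) x : joins J1 J2 J ->
  chi J x = chi J1 x + chi J2 x.
Proof.
move=> /joins_ends[h l r]; rewrite !chiE l r h.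
have := lo_lt_hi J1; have := lo_lt_hi J2; rewrite h.
case: (leP (lo J1) x); case: (leP (lo J2) x);
  case: (ltP x (hi J2)) => //= *; exfalso; lra.
Qed.

End StepCalculus.

(** * Linear maps defined on a basis *)

Lemma seq_argmax (T : eqType) (h : T -> int) (s : seq T) (t : T) : t \in s ->
  exists2 m, m \in s & forall t', t' \in s -> h t' <= h m.
Proof.
elim: s t => // a [_ _ _|b s IH _ _].
  by exists a; rewrite ?mem_head // => t; rewrite inE => /eqP ->.
have [m ms mmax] := IH b (mem_head _ _).
have [am|/ltW ma] := leP (h a) (h m).
  exists m => [|t]; first by rewrite inE ms orbT.
  by rewrite inE => /orP[/eqP ->|/mmax].
exists a => [|t]; first exact: mem_head.
by rewrite inE => /orP[/eqP ->|/mmax tm] //; apply: le_trans ma.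
Qed.

Section LinearExtension.
Variables (A : comUnitRingType) (T : choiceType) (V : lmodType A).
Implicit Types (f : T -> V) (x : malg T A).

Definition lin_ext f x : V := \sum_(k <- msupp x) mcoeff k x *: f k.

Lemma lin_extEw f x (d : {fset T}) : (msupp x `<=` d)%fset ->
  lin_ext f x = \sum_(k <- d) mcoeff k x *: f k.
Proof.
move=> le; rewrite [LHS](big_fset_incl _ le) //= => k kd /mcoeff_outdom ->.
by rewrite scale0r.
Qed.

Lemma lin_ext_is_linear f : linear (lin_ext f).
Proof.
move=> c x y; pose d := (msupp x `|` msupp y `|` msupp (c *: x + y))%fset.
have dx : (msupp x `<=` d)%fset.
  by rewrite /d -fsetUA fsubsetUl.
have dy : (msupp y `<=` d)%fset.
  by rewrite /d -fsetUA fsetUCA fsubsetUl.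
rewrite (lin_extEw f dx) (lin_extEw f dy) (@lin_extEw f _ d) ?fsubsetUr //.
rewrite scaler_sumr -big_split /=; apply: eq_bigr => k _.
by rewrite mcoeffD mcoeffZ scalerDl scalerA.
Qed.

HB.instance Definition _ f :=
  GRing.isLinear.Build A (malg T A) V *:%R (lin_ext f) (lin_ext_is_linear f).

Lemma lin_ext1 f k : lin_ext f (mkmalgU k 1) = f k.
Proof.
by rewrite (lin_extEw f (d := [fset k]%fset)) ?msuppU_le // big_seq_fset1
  mcoeffUU scale1r.
Qed.

Lemma malg_basis x : x = \sum_(k <- msupp x) mcoeff k x *: mkmalgU k 1.
Proof.
rewrite {1}[x]monalgE; apply: eq_bigr => k _.
apply/malgP => k'; rewrite mcoeffZ !mcoeffU mulrnAr.
by rewrite mulr1.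
Qed.

Lemma linear_malg_ext (g h : malg T A -> V) : linear g -> linear h ->
  (forall k, g (mkmalgU k 1) = h (mkmalgU k 1)) -> g =1 h.
Proof.
move=> gl hl gh x.
pose g' : {linear malg T A -> V} :=
  HB.pack g (GRing.isLinear.Build _ _ _ _ g gl).
pose h' : {linear malg T A -> V} :=
  HB.pack h (GRing.isLinear.Build _ _ _ _ h hl).
rewrite -[LHS]/(g' x) -[RHS]/(h' x) [x]malg_basis !linear_sum.
by apply: eq_bigr => k _; rewrite !linearZ; congr (_ *: _); apply: gh.
Qed.

End LinearExtension.

(** * The hop operators *)

Section FockRepresentation.
Variables (A : comUnitRingType) (q : A) (R : realType) (K : set R).
Hypothesis q_unit : q \is a GRing.unit.
Local Notation itv := (kinterval K).
Local Notation pyramid := (pyramid K).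
Local Notation F := (Fock A K).
Local Notation v := (q ^+ 2).
Local Notation ket p := (ket A p).
Implicit Types (J I : itv) (p : pyramid) (f : R -> int) (e : int) (x y : F).

Lemma v_unit : v \is a GRing.unit. Proof. by rewrite unitrX. Qed.
Lemma Nv_unit : - v \is a GRing.unit. Proof. by rewrite unitrN v_unit. Qed.

(** The basis vector of a function that may fail to be a pyramid, and then 0; with
    it the formulas for E and F need no case distinction. *)
Definition ketf f : F :=
  if pselect (is_pyramid K f) is left fP then ket (Pyramid fP) else 0.

Lemma ketf_pyramid f (fP : is_pyramid K f) : ketf f = ket (Pyramid fP).
Proof.
by rewrite /ketf; case: pselect => // fP'; rewrite (Prop_irrelevance fP' fP).
Qed.

Lemma ketf_pyr p : ketf p = ket p.
Proof. by case: p => f fP /=; rewrite ketf_pyramid. Qed.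

Lemma ketf_out f : ~ is_pyramid K f -> ketf f = 0.
Proof. by rewrite /ketf; case: pselect. Qed.

Definition coef e J f : A := e%:~R * q * (- v) ^ (e * (f (lo J) - f (hi J))).

(** F_J for e = 1 and E_J for e = -1 (see [hop_add] and [hop_rem]). *)
Definition hop e J : F -> F :=
  lin_ext (fun p => coef e J p *: ketf (add_chi e J p)).

Definition weight e J : F -> F := lin_ext (fun p => v ^ (e * nJ J p) *: ket p).

HB.instance Definition _ e J := GRing.Linear.on (hop e J).
HB.instance Definition _ e J := GRing.Linear.on (weight e J).

Lemma hop_ketf e J f : is_pyramid K f ->
  hop e J (ketf f) = coef e J f *: ketf (add_chi e J f).
Proof. by move=> fP; rewrite (ketf_pyramid fP) /hop lin_ext1. Qed.

Lemma weight_ketf e J f :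
  weight e J (ketf f) = v ^ (e * (occ f (hi J) - occ f (lo J))) *: ketf f.
Proof.
have [fP|nP] := pselect (is_pyramid K f); last first.
  by rewrite ketf_out // linear0 scaler0.
by rewrite (ketf_pyramid fP) /weight lin_ext1 nJE.
Qed.

Lemma hop_hop e e' J J' f : is_pyramid K f ->
  is_pyramid K (add_chi e' J' f) ->
  hop e J (hop e' J' (ketf f)) =
  (coef e' J' f * coef e J (add_chi e' J' f))
    *: ketf (add_chi e J (add_chi e' J' f)).
Proof. by move=> fP sP; rewrite hop_ketf // linearZ /= hop_ketf // scalerA. Qed.

Lemma hop_hop_out e e' J J' f : is_pyramid K f ->
  ~ is_pyramid K (add_chi e' J' f) -> hop e J (hop e' J' (ketf f)) = 0.
Proof. by move=> fP sP; rewrite hop_ketf // ketf_out // scaler0 linear0. Qed.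

Lemma fock_ext (g h : F -> F) : linear g -> linear h ->
  (forall f, is_pyramid K f -> g (ketf f) = h (ketf f)) -> g =1 h.
Proof.
move=> gl hl gh; apply: linear_malg_ext => // p.
by have := gh p (pyrP p); rewrite ketf_pyr.
Qed.

(** The second and third hypotheses say that neither move changes the exponent in
    the coefficient of the other. *)
Lemma hop_comm e e' J J' :
  (forall z, dchi J z = 0 \/ dchi J' z = 0) ->
  chi J (lo J') = chi J (hi J') -> chi J' (lo J) = chi J' (hi J) ->
  hop e J \o hop e' J' =1 hop e' J' \o hop e J.
Proof.
move=> JJ cJ cJ'.
apply: fock_ext; [exact: linearP|exact: linearP|move=> f fP /=].
have coef_add_chi d d' I I' : chi I (lo I') = chi I (hi I') ->
    coef d' I' (add_chi d I f) = coef d' I' f.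
  rewrite /coef /add_chi => ->; congr (_ * _ ^ (_ * _)).
  by rewrite opprD addrACA subrr addr0.
have J'J z : dchi J' z = 0 \/ dchi J z = 0 by have [] := JJ z; tauto.
have [gP|gN] := pselect (is_pyramid K (add_chi e J (add_chi e' J' f))).
  have sP := add_chi_swap JJ fP gP; have gP' := gP; rewrite add_chiC in gP'.
  have sP' := add_chi_swap J'J fP gP'.
  rewrite (hop_hop e J fP sP') (hop_hop e' J' fP sP) add_chiC.
  by rewrite (coef_add_chi _ _ _ _ cJ) (coef_add_chi _ _ _ _ cJ') mulrC.
have H d d' I I' :
    add_chi d I (add_chi d' I' f) = add_chi e J (add_chi e' J' f) ->
    hop d I (hop d' I' (ketf f)) = 0.
  move=> E; have [sP|sN] := pselect (is_pyramid K (add_chi d' I' f)).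
    by rewrite hop_hop // E ketf_out // scaler0.
  exact: hop_hop_out.
by rewrite !H // add_chiC.
Qed.

Lemma hop_clash e e' J J' z : e * dchi J z = e' * dchi J' z ->
  e * dchi J z != 0 -> forall x, hop e J (hop e' J' x) = 0.
Proof.
move=> ee nz; apply: (@fock_ext (hop e J \o hop e' J') (fun=> 0)).
- exact: linearP.
- by move=> c x y; rewrite scaler0 addr0.
move=> f fP /=; have [sP|sN] := pselect (is_pyramid K (add_chi e' J' f)).
  by rewrite hop_hop // (ketf_out (add_chi_clash ee nz fP)) scaler0.
exact: hop_hop_out.
Qed.

Lemma hop_comm_before e e' J J' : hi J < lo J' ->
  hop e J \o hop e' J' =1 hop e' J' \o hop e J.
Proof.
move=> h; have l := lo_lt_hi J; have l' := lo_lt_hi J'.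
apply: hop_comm => [z||].
- have [->|n1] := eqVneq z (lo J).
    by right; apply: dchi_out; rewrite lt_eqF //; lra.
  have [->|n2] := eqVneq z (hi J).
    by right; apply: dchi_out; rewrite lt_eqF //; lra.
  by left; apply: dchi_out.
- by rewrite !chiE ![_ < hi J]le_gtF ?andbF; lra.
- by rewrite !chiE ![lo J' <= _]lt_geF //; lra.
Qed.

Lemma hop_comm_nested e e' J J' : lo J' < lo J -> hi J < hi J' ->
  hop e J \o hop e' J' =1 hop e' J' \o hop e J.
Proof.
move=> h1 h2; have l := lo_lt_hi J; have l' := lo_lt_hi J'.
apply: hop_comm => [z||].
- have [->|n1] := eqVneq z (lo J).
    by right; apply: dchi_out; [rewrite gt_eqF|rewrite lt_eqF //; lra].
  have [->|n2] := eqVneq z (hi J).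
    by right; apply: dchi_out; [rewrite gt_eqF //; lra|rewrite lt_eqF //].
  by left; apply: dchi_out.
- by rewrite !chiE (lt_geF h1) (le_gtF (ltW h2)) andbF.
- by rewrite !chiE h2 (ltW h1) (lt_trans l h2) (ltW (lt_trans h1 l)).
Qed.

Lemma coef_mul e J J' f g : e * e = 1 -> coef e J f * coef e J' g =
  v * (- v) ^ (e * (f (lo J) - f (hi J) + (g (lo J') - g (hi J')))).
Proof.
move=> ee; rewrite /coef mulrACA -exprzDr ?Nv_unit // -mulrDr mulrACA.
by rewrite -rmorphM ee rmorph1 mul1r expr2.
Qed.

(** After the first move the value at the left endpoint has changed by e, which
    contributes a factor (-v)^(-1), compensating the factor - q^2 = - v. *)
Lemma coef_inv e J f : e * e = 1 ->
  coef e J f * coef (- e) J (add_chi e J f) = 1.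
Proof.
move=> ee; rewrite /coef /add_chi !chiE lexx ltxx lo_lt_hi andbF /=.
rewrite mulr1 mulr0 addr0.
rewrite mulrACA -exprzDr ?Nv_unit //.
have -> : e * (f (lo J) - f (hi J)) + - e * (f (lo J) + e - f (hi J)) = -1.
  by rewrite -ee; lia.
rewrite exprN1 mulrACA -rmorphM /= mulrN ee -expr2.
by rewrite rmorphN rmorph1 mulN1r divrr // Nv_unit.
Qed.

Lemma hop_inv e J f : e * e = 1 -> is_pyramid K f ->
  hop (- e) J (hop e J (ketf f)) =
  if `[< is_pyramid K (add_chi e J f) >] then ketf f else 0.
Proof.
move=> ee fP; case: asboolP => sP; last exact: hop_hop_out.
by rewrite hop_hop // coef_inv // scale1r add_chiK.
Qed.

(** Write b = hi J1.  When e = 1 the site hi J loses a particle and lo J gains one,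
    by way of b; when e = -1 it is the other way round.  If b is occupied for
    e = 1, or empty for e = -1, the move along J1 has to come first.  Otherwise
    the move along J2 does, and then it changes the value at b by e before the move along J1 is performed,
    hence an extra factor (-v)^(-1), which turns - q v into q. *)
Lemma hop_join e J1 J2 J f : e * e = 1 -> joins J1 J2 J -> is_pyramid K f ->
  hop e J (ketf f) = e%:~R *: (q^-1 *: hop e J2 (hop e J1 (ketf f))
                               - q *: hop e J1 (hop e J2 (ketf f))).
Proof.
move=> ee JJ fP; have [h l r] := joins_ends JJ.
have l1 := lo_lt_hi J1; have l2 := lo_lt_hi J2.
have sJ : add_chi e J2 (add_chi e J1 f) = add_chi e J f.
  by apply/funext => z; rewrite /add_chi (joins_chi z JJ) mulrDr addrA.
have sJ' : add_chi e J1 (add_chi e J2 f) = add_chi e J f by rewrite add_chiC.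
have e1 : `|e| = 1 by nia.
rewrite hop_ketf //.
have [gP|gN] := pselect (is_pyramid K (add_chi e J f)); last first.
  have H I I' : add_chi e I (add_chi e I' f) = add_chi e J f ->
      hop e I (hop e I' (ketf f)) = 0.
    move=> E; have [sP|sN] := pselect (is_pyramid K (add_chi e I' f)).
      by rewrite hop_hop // E ketf_out // scaler0.
    exact: hop_hop_out.
  by rewrite !H // !scaler0 subrr scaler0 ketf_out // scaler0.
have [ol oh] := (add_chi_pyramidE J e1 fP).1 gP; rewrite l in ol; rewrite r in oh.
have hb := pyramid_occ_range (hi J1) fP.
(* e = 1 needs b occupied to move along J1, e = -1 needs it empty *)
have [b|b] := eqVneq (occ f (hi J1)) (e == 1)%:Z.
  have P1 : is_pyramid K (add_chi e J1 f) by apply/add_chi_pyramidE.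
  have N2 : ~ is_pyramid K (add_chi e J2 f).
    by move=> /(add_chi_pyramidE J2 e1 fP)[]; rewrite -h b; nia.
  rewrite (hop_hop e J2 fP P1) sJ (hop_hop_out _ _ fP N2) scaler0 subr0 !scalerA.
  congr (_ *: _).
  rewrite coef_mul // /coef /add_chi !chiE -h ltxx andbF h le_gtF ?(ltW l2) // andbF.
  rewrite !mulr0 !addr0 l r -h addrA subrK -!mulrA; congr (_ * _).
  by rewrite mulKr.
have P2 : is_pyramid K (add_chi e J2 f).
  by apply/add_chi_pyramidE => //; rewrite -h; nia.
have N1 : ~ is_pyramid K (add_chi e J1 f).
  by move=> /(add_chi_pyramidE J1 e1 fP)[_ E]; rewrite E eqxx in b.
rewrite (hop_hop e J1 fP P2) sJ' (hop_hop_out _ _ fP N1) scaler0.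
rewrite sub0r scalerN !scalerA -scaleNr.
congr (_ *: _); rewrite h in l1.
rewrite coef_mul // /coef /add_chi !chiE h lexx l2 (lt_geF l1) /=.
rewrite mulr0 addr0 mulr1 l r.
have -> : e * (f (lo J2) - f (hi J2) + (f (lo J1) - (f (lo J2) + e))) =
  e * (f (lo J1) - f (hi J2)) - 1 by rewrite -ee; lia.
rewrite exprzDr ?Nv_unit // exprN1 [e%:~R * (_ * _)]mulrA -mulrN.
congr (_ * _).
by rewrite -[RHS]mulNr [RHS]mulrCA mulrV ?Nv_unit // mulr1.
Qed.

(** * The relations of the quantum group *)

Lemma weight_hop d e I J f : is_pyramid K f ->
  weight d I (hop e J (ketf f)) =
  v ^ (d * (occ f (hi I) - occ f (lo I))
       + d * e * (dchi J (hi I) - dchi J (lo I))) *: hop e J (ketf f).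
Proof.
move=> fP; have fl := pyramid_left_limits fP.
rewrite (hop_ketf e J fP) linearZ /= weight_ketf !(occ_add_chi e J _ fl).
by rewrite scalerA mulrC -scalerA; congr (v ^ _ *: _); ring.
Qed.

Lemma weight_weight d d' I I' f : weight d I (weight d' I' (ketf f)) =
  v ^ (d * (occ f (hi I) - occ f (lo I)) + d' * (occ f (hi I') - occ f (lo I')))
    *: ketf f.
Proof.
by rewrite weight_ketf linearZ /= weight_ketf scalerA -exprzDr ?v_unit // addrC.
Qed.

(** With a common endpoint both sides vanish, since both moves act on it in the
    same way; otherwise both exponents are 0. *)
Lemma nested_hops e J1 J2 x : e != 0 -> ico J1 `<=` ico J2 ->
  v ^ (euler (chi J1) (chi J2)) *: hop e J1 (hop e J2 x) =
  v ^ (euler (chi J2) (chi J1)) *: hop e J2 (hop e J1 x).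
Proof.
move=> e0 /subset_ico[]; have l1 := lo_lt_hi J1; have l2 := lo_lt_hi J2.
have clash z : dchi J1 z = dchi J2 z -> dchi J1 z != 0 ->
    hop e J1 (hop e J2 x) = 0 /\ hop e J2 (hop e J1 x) = 0.
  move=> c n; split.
    by apply: (@hop_clash e e _ _ z); [rewrite c|rewrite mulf_neq0].
  by apply: (@hop_clash e e _ _ z); [rewrite c|rewrite mulf_neq0 // -c].
rewrite le_eqVlt => /orP[/eqP l _|l].
  have [|| -> ->] := clash (lo J1); rewrite ?scaler0 //;
    by rewrite dchi_lo // -l dchi_lo.
rewrite le_eqVlt => /orP[/eqP h|h].
  have [|| -> ->] := clash (hi J1); rewrite ?scaler0 //;
    by rewrite dchi_hi // h dchi_hi.
have -> : euler (chi J1) (chi J2) = 0.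
  by rewrite euler_chi (lt_geF h) (le_gtF (ltW l)) andbF.
have -> : euler (chi J2) (chi J1) = 0.
  by rewrite euler_chi l (lt_trans l l1) (ltW h) (ltW (lt_trans l1 h)).
by have /= -> := hop_comm_nested e e l h x.
Qed.

Fixpoint interp (t : qterm A K) : F -> F :=
  match t with
  | QE J => hop (-1) J
  | QF J => hop 1 J
  | QK J => weight 1 J
  | QKinv J => weight (-1) J
  | Q0 => fun=> 0
  | Q1 => id
  | Qopp s => fun x => - interp s x
  | Qadd s s' => fun x => interp s x + interp s' x
  | Qmul s s' => fun x => interp s (interp s' x)
  | Qscale c s => fun x => c *: interp s x
  end.

Lemma interp_linear t : linear (interp t).
Proof.
elim: t => /= [J|J|J|J|||s IH|s IH s' IH'|s IH s' IH'|a s IH] c x y.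
1-4: exact: linearP.
- by rewrite scaler0 addr0.
- by [].
- by rewrite IH opprD scalerN.
- by rewrite IH IH' scalerDr addrACA.
- by rewrite IH' IH.
- by rewrite IH scalerDr !scalerA mulrC.
Qed.

(** Both sides are linear, so each relation is checked on basis vectors. *)
Lemma interp_rel s t : qrel q s t -> interp s =1 interp t.
Proof.
move=> st.
apply: fock_ext; [exact: interp_linear|exact: interp_linear|move=> f fP].
have hop_lin e J c x : hop e J (c *: x) = c *: hop e J x by rewrite linearZ.
have wt_lin e J c x : weight e J (c *: x) = c *: weight e J x.
  by rewrite linearZ.
case: st => /=.
- by move=> J; rewrite weight_weight mul1r mulN1r subrr expr0z scale1r.
- by move=> J; rewrite weight_weight mul1r mulN1r addNr expr0z scale1r.
- move=> I1 I2; rewrite !weight_weight; apply/eqP; rewrite subr_eq0.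
  by rewrite [X in v ^ X *: _ == _]addrC.
- move=> I J; rewrite weight_ketf hop_lin wt_lin weight_hop //.
  rewrite scalerA -exprzDr ?v_unit //.
  by rewrite sym_euler_chi; congr (v ^ _ *: _); lia.
- move=> I J; rewrite weight_ketf hop_lin wt_lin weight_hop //.
  rewrite scalerA -exprzDr ?v_unit //.
  by rewrite sym_euler_chi; congr (v ^ _ *: _); lia.
- move=> J1 J2 /disjoint_ico[]; rewrite le_eqVlt => /orP[/eqP h|h].
  + have c : 1 * dchi J1 (hi J1) = -1 * dchi J2 (hi J1).
      by rewrite dchi_hi h dchi_lo.
    rewrite (hop_clash c) ?dchi_hi //.
    by rewrite (hop_clash (esym c)) ?subrr // -c dchi_hi.
  + by have /= -> := hop_comm_before 1 (-1) h (ketf f); rewrite subrr.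
  + have c : 1 * dchi J1 (hi J2) = -1 * dchi J2 (hi J2).
      by rewrite dchi_hi h dchi_lo.
    rewrite (hop_clash c) ?h ?dchi_lo //.
    by rewrite (hop_clash (esym c)) ?subrr // -c h dchi_lo.
  + by have /= -> := hop_comm_before (-1) 1 h (ketf f); rewrite subrr.
- move=> J; rewrite (@hop_inv 1 J f) //.
  rewrite -[hop 1 J (hop (-1) J _)]/(hop (- -1) J (hop (-1) J _)).
  rewrite hop_inv // !weight_ketf.
  have := pyramid_occ_range (lo J) fP; have := pyramid_occ_range (hi J) fP.
  case: asboolP => [aP|aN]; case: asboolP => [rP|rN].
  + have := (add_chi_pyramidE J (normr1 int) fP).1 aP.
    by have := (add_chi_pyramidE J (normrN1 int) fP).1 rP => -[-> ->] [].
  + have := (add_chi_pyramidE J (normr1 int) fP).1 aP => -[-> ->].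
    by rewrite subr0 -scalerBl.
  + have := (add_chi_pyramidE J (normrN1 int) fP).1 rP => -[-> ->] _ _.
    by rewrite sub0r scalerN -scalerBl -scaleNr opprB.
  + move=> h l; have -> : occ f (hi J) = occ f (lo J).
      have a := (add_chi_pyramidE J (normr1 int) fP).2.
      have r := (add_chi_pyramidE J (normrN1 int) fP).2.
      suff: ~ (occ f (lo J) = 0 /\ occ f (hi J) = 1) /\
        ~ (occ f (lo J) = 1 /\ occ f (hi J) = 0) by lia.
      by split=> H; [apply/aN/a|apply/rN/r].
    by rewrite !subrr ?mulr0 scaler0 ?subrr.
- move=> J1 J2 J JJ; have [h l r] := joins_ends JJ.
  by rewrite weight_weight weight_ketf l r h; congr (v ^ _ *: _); lia.
- by move=> J1 J2 J JJ; rewrite (@hop_join (-1) J1 J2 J f) // scaleN1r opprB.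
- by move=> J1 J2 J JJ; rewrite (@hop_join 1 J1 J2 J f) // scale1r.
- move=> J1 J2 /apart_ico[] h.
    by have /= -> := hop_comm_before (-1) (-1) h (ketf f); rewrite subrr.
  by have /= -> := hop_comm_before (-1) (-1) h (ketf f); rewrite subrr.
- move=> J1 J2 /apart_ico[] h.
    by have /= -> := hop_comm_before 1 1 h (ketf f); rewrite subrr.
  by have /= -> := hop_comm_before 1 1 h (ketf f); rewrite subrr.
- by move=> J1 J2; apply: nested_hops.
- by move=> J1 J2; apply: nested_hops.
Qed.

(** * Existence and uniqueness of the action *)

Lemma qeq_interp s t : qeq q s t -> interp s =1 interp t.
Proof.
elim=> {s t} /= [s t||||||||||||||||||||||].
- exact: interp_rel.
- by [].
- by move=> s t _ H x.
- by move=> s t u _ H _ H' x; rewrite H.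
- by move=> s s' _ H x; rewrite H.
- by move=> s s' t t' _ H _ H' x; rewrite H H'.
- by move=> s s' t t' _ H _ H' x; rewrite H' H.
- by move=> c s s' _ H x; rewrite H.
- by move=> s t u x; rewrite addrA.
- by move=> s t x; rewrite addrC.
- by move=> s x; rewrite add0r.
- by move=> s x; rewrite addNr.
- by [].
- by [].
- by [].
- by [].
- move=> s t u x.
  by have := interp_linear s 1 (interp t x) (interp u x); rewrite !scale1r.
- by move=> c d s x; rewrite scalerA.
- by move=> s x; rewrite scale1r.
- by move=> c s t x; rewrite scalerDr.
- by move=> c d s x; rewrite scalerDl.
- by [].
- move=> c s t x.
  have := interp_linear s c (interp t x) 0; rewrite !addr0.
  have -> : interp s 0 = 0; last by rewrite addr0 => ->.
  by have := interp_linear s (-1) 0 0; rewrite scaler0 addr0 scaleN1r addNr.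
Qed.

Definition fock_act (u : Uq q K) : F -> F := interp (repr u).

Lemma fock_act_qpi t : fock_act (qpi q t) =1 interp t.
Proof. exact/qeq_interp/repr_qpi. Qed.

Lemma fock_act_module : is_module fock_act.
Proof.
split=> [u|x c u u'|x|u u' x]; first exact: interp_linear.
- rewrite -[c *: u + u']/(qpi q (Qadd (repr (c *: u)) (repr u'))).
  rewrite fock_act_qpi /=.
  by congr (_ + _); exact: fock_act_qpi (Qscale c (repr u)) x.
- by rewrite fock_act_qpi.
- by rewrite -[u * u']/(qpi q (Qmul (repr u) (repr u'))) fock_act_qpi.
Qed.

Lemma hop_ket e J p : hop e J (ket p) = coef e J p *: ketf (add_chi e J p).
Proof. by rewrite -ketf_pyr hop_ketf //; apply: pyrP. Qed.

Lemma weight_ket e J p : weight e J (ket p) = v ^ (e * nJ J p) *: ket p.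
Proof. exact: lin_ext1. Qed.

Lemma hop_add J p (add : addable J p) :
  hop 1 J (ket p) = (q * (- v) ^ (p (lo J) - p (hi J))) *: ket (Pyramid add).
Proof.
rewrite hop_ket /coef !mul1r -ketf_pyramid; congr (_ *: ketf _).
by apply/funext => x; rewrite /add_chi mul1r.
Qed.

Lemma hop_rem J p (rem : removable J p) :
  hop (-1) J (ket p) =
    (- q * (- v) ^ (p (hi J) - p (lo J))) *: ket (Pyramid rem).
Proof.
rewrite hop_ket /coef !mulN1r opprB -ketf_pyramid; congr (_ *: ketf _).
by apply/funext => x; rewrite /add_chi mulN1r.
Qed.

Lemma hop_not_add J p : ~ addable J p -> hop 1 J (ket p) = 0.
Proof. by move=> nadd; rewrite hop_ket ketf_out ?scaler0 // => /addableE. Qed.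

Lemma hop_not_rem J p : ~ removable J p -> hop (-1) J (ket p) = 0.
Proof. by move=> nrem; rewrite hop_ket ketf_out ?scaler0 // => /removableE. Qed.

Lemma fock_act_action : fock_action fock_act.
Proof.
split; first exact: fock_act_module.
split=> J p; rewrite fock_act_qpi /=.
- by split; [exact: hop_rem|exact: hop_not_rem].
- by split; [exact: hop_add|exact: hop_not_add].
- by rewrite weight_ket mul1r.
Qed.

(** By induction on expressions; the inverse of [K_J] acts by the inverse of the
    eigenvalue on |p> because [K_J] acts on |p> by an invertible scalar. *)
Lemma fock_action_unique act : fock_action act -> act = fock_act.
Proof.
case=> [[actl acts act1 actM] [actE actF actK]].
have act0 u : act u 0 = 0.
  by have := actl u (-1) 0 0; rewrite scaler0 addr0 scaleN1r addNr.
have actZ u c x : act u (c *: x) = c *: act u x.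
  by rewrite -[c *: x in LHS]addr0 actl act0 addr0.
have s0 x : act 0 x = 0.
  by have := acts x (-1) 0 0; rewrite scaler0 addr0 scaleN1r addNr.
have sZ c u x : act (c *: u) x = c *: act u x.
  by rewrite -[c *: u in LHS]addr0 acts s0 addr0.
have sD u u' x : act (u + u') x = act u x + act u' x.
  by rewrite -[u in LHS]scale1r acts scale1r.
suff H t x : act (qpi q t) x = interp t x.
  by apply/funext => u; apply/funext => x; rewrite -{1}(qpi_repr u) H.
have ket_ext u (h : F -> F) : linear h ->
    (forall p, act u (ket p) = h (ket p)) -> act u =1 h.
  by move=> hl; apply: linear_malg_ext.
elim: t x => /= [J|J|J|J|||s IH|s IH s' IH'|s IH s' IH'|c s IH].
- apply: ket_ext => [|p]; first exact: linearP.
  have [aE naE] := actE J p; have [rem|nrem] := pselect (removable J p).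
    by rewrite [LHS]aE hop_rem.
  by rewrite [LHS]naE // hop_not_rem.
- apply: ket_ext => [|p]; first exact: linearP.
  have [aF naF] := actF J p; have [add|nadd] := pselect (addable J p).
    by rewrite [LHS]aF hop_add.
  by rewrite [LHS]naF // hop_not_add.
- apply: ket_ext => [|p]; first exact: linearP.
  by rewrite [LHS]actK weight_ket mul1r.
- apply: ket_ext => [|p]; first exact: linearP.
  rewrite weight_ket -{1}[ket p]scale1r.
  have -> : 1 = v ^ (-1 * nJ J p) * v ^ nJ J p.
    by rewrite -exprzDr ?v_unit // mulN1r addNr.
  rewrite -scalerA -actK actZ -actM -[qpi q (QKinv _ J) * _]qpi_mul.
  by rewrite (qpi_eq (Qeq_rel (QrelVK q J))) act1.
- exact: s0.
- exact: act1.
- move=> x; rewrite qpi_opp -[Uq_opp _]/(- qpi q s).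
  by rewrite -[in LHS]scaleN1r [LHS]sZ scaleN1r IH.
- by move=> x; rewrite qpi_add [LHS]sD IH IH'.
- by move=> x; rewrite qpi_mul [LHS]actM IH IH'.
- by move=> x; rewrite qpi_scale [LHS]sZ IH.
Qed.

Lemma exists_unique_fock_action : exists! act, @fock_action A q R K act.
Proof.
exists fock_act; split; first exact: fock_act_action.
by move=> act /fock_action_unique.
Qed.

Lemma fock_act_sum (I : eqType) (r : seq I) (c : I -> A) (u : I -> Uq q K) x :
  fock_act (\sum_(i <- r) c i *: u i) x = \sum_(i <- r) c i *: fock_act (u i) x.
Proof.
have [_ acts _ _] := fock_act_module.
elim: r => [|i r IH]; last by rewrite !big_cons acts IH.
rewrite !big_nil; have := acts x (-1) 0 0.
by rewrite scaler0 addr0 scaleN1r addNr.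
Qed.

Lemma fock_actZ c u x : fock_act (c *: u) x = c *: fock_act u x.
Proof.
by have := @fock_act_sum _ [:: tt] (fun=> c) (fun=> u) x; rewrite !big_seq1.
Qed.

Lemma fock_actM u u' x : fock_act (u * u') x = fock_act u (fock_act u' x).
Proof. by have [_ _ _ ->] := fock_act_module. Qed.

HB.instance Definition _ u :=
  GRing.isLinear.Build A F F *:%R (fock_act u) (interp_linear (repr u)).

(** * Highest weight and irreducibility *)

Definition vacuum : pyramid := Pyramid (zero_pyramid K).

Lemma pyramid_inj p p' : (p : R -> int) = p' -> p = p'.
Proof.
case: p p' => f fP [f' fP'] /= E; case: _ / E fP' => fP'.
by rewrite (Prop_irrelevance fP fP').
Qed.

Lemma height0_vacuum p : p 0 <= 0 -> p = vacuum.
Proof.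
by move=> p0; apply: pyramid_inj; exact: pyramid_height0 (pyrP p) p0.
Qed.

Lemma coef_unit e J f : `|e| = 1 -> coef e J f \is a GRing.unit.
Proof.
move=> e1; rewrite /coef !unitrM q_unit unitrXz ?Nv_unit // !andbT.
have [->|->] : e = 1 \/ e = -1 by lia.
  by rewrite rmorph1 unitr1.
by rewrite rmorphN1 unitrN unitr1.
Qed.

Lemma add_chi_height e J f : lo J <= 0 -> 0 < hi J -> add_chi e J f 0 = f 0 + e.
Proof. by move=> l h; rewrite /add_chi chiE l h mulr1. Qed.

(** Induction on the height: |p> is obtained from |p - 1_J> by F_J, up to a unit,
    for a removable interval J around 0. *)
Lemma vacuum_generates p : exists u, fock_act u (ket vacuum) = ket p.
Proof.
have [n] : exists n : nat, p 0 <= n%:Z by exists `|p 0%R|%N; lia.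
elim: n p => [|n IH] p pn.
  exists 1; rewrite (height0_vacuum pn); exact: fock_act_qpi.
have [/height0_vacuum ->|p0] := leP (p 0) 0.
  by exists 1; exact: fock_act_qpi.
have [J [remP l h]] := removable_ex (pyrP p) p0.
have [|u uP] := IH (Pyramid remP); first by rewrite /= add_chi_height //; lia.
have cu := @coef_unit 1 J (add_chi (-1) J p) (normr1 int).
exists ((coef 1 J (add_chi (-1) J p))^-1 *: (UF q J * u)).
rewrite fock_actZ fock_actM uP fock_act_qpi /= hop_ket /=.
rewrite scalerA mulVr // scale1r.
by rewrite -[X in ketf X]/(add_chi (- -1) J _) add_chiK ketf_pyr.
Qed.

Lemma vacuum_cyclic y : exists u, y = fock_act u (ket vacuum).
Proof.
have [u uP] := boolp.choice vacuum_generates.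
exists (\sum_(p <- msupp y) mcoeff p y *: u p).
by rewrite fock_act_sum {1}[y]malg_basis; apply: eq_bigr => p _; rewrite uP.
Qed.

Lemma ket_neq0 p : ket p != 0.
Proof. by rewrite monalgU_eq0 oner_eq0. Qed.

Lemma fock_act_highest_weight : highest_weight fock_act.
Proof.
exists (ket vacuum); split.
- exact: ket_neq0.
- move=> J; rewrite fock_act_qpi; apply: hop_not_rem => -[_ /(_ (lo J)) /=].
  by rewrite chiE lexx lo_lt_hi.
- by move=> J; eexists; rewrite fock_act_qpi /= weight_ket.
- exact: vacuum_cyclic.
Qed.

(** For n + 1, first apply E_J for a removable interval J of p around 0.  If J is
    also removable from p', then p' - 1_J differs from p - 1_J and has height at
    most n, so the induction hypothesis kills it. *)
Lemma lowering (n : nat) p : p 0 = n%:Z -> exists u c,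
  [/\ c \is a GRing.unit, fock_act u (ket p) = c *: ket vacuum
    & forall p', p' != p -> p' 0 <= n%:Z -> fock_act u (ket p') = 0].
Proof.
elim: n p => [|n IH] p pn.
  exists 1, 1; split; rewrite ?unitr1 //.
    by rewrite fock_act_qpi scale1r (@height0_vacuum p) // pn.
  move=> p' + p'0; rewrite (height0_vacuum p'0) (@height0_vacuum p) ?pn //.
  by rewrite eqxx.
have [|J [remP l h]] := removable_ex (pyrP p); first by rewrite pn.
have [|u [c [cU uc u0]]] := IH (Pyramid remP).
  by rewrite /= add_chi_height // pn; lia.
exists (u * UE q J), (coef (-1) J p * c); split.
- by rewrite unitrM cU coef_unit.
- rewrite fock_actM fock_act_qpi /= hop_ket (ketf_pyramid remP) linearZ /= uc.
  by rewrite scalerA.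
move=> p' p'p p'n; rewrite fock_actM fock_act_qpi /= hop_ket.
have [rP|rN] := pselect (is_pyramid K (add_chi (-1) J p')); last first.
  by rewrite ketf_out // scaler0 linear0.
rewrite (ketf_pyramid rP) linearZ /= u0 ?scaler0 //=.
  apply: contra_neq p'p => /(congr1 (fun p : pyramid => p : R -> int)) /= E.
  by apply: pyramid_inj; rewrite -(add_chiK (-1) J p') E add_chiK.
by rewrite add_chi_height //; lia.
Qed.

(** In the support of a nonzero vector, choose a pyramid p of maximal height: the
    lowering element attached to p sends the vector to an invertible multiple of
    the vacuum. *)
Lemma fock_act_irreducible : (forall a : A, a != 0 -> a \is a GRing.unit) ->
  irreducible fock_act.
Proof.
move=> fieldA; split; first by exists (ket vacuum); exact: ket_neq0.
move=> N [N0 Nlin] Nact.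
have [H|] := pselect (forall x, x \in N -> x = 0); first by left.
move=> /existsNP[x /not_implyP[xN /eqP x0]]; right.
suff vN : ket vacuum \in N.
  by move=> y; have [u ->] := vacuum_cyclic y; apply: Nact.
have [p px pmax] :
    exists2 p, p \in msupp x & forall p', p' \in msupp x -> p' 0 <= p 0.
  have /fset0Pn[p0 p0x] : msupp x != fset0.
    by apply: contra_neq x0 => E; rewrite [x]malg_basis E big_seq_fset0.
  exact: (seq_argmax (fun p : pyramid => p 0) p0x).
have [n pn] : exists n : nat, p 0 = n%:Z.
  by exists `|p 0%R|%N; have [_ /(_ 0)] := pyrP p; lia.
have [u [c [cU uc u0]]] := lowering pn.
have E : fock_act u x = (mcoeff p x * c) *: ket vacuum.
  rewrite [x in LHS]malg_basis linear_sum (big_fsetD1 p) //=.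
  rewrite linearZ /= uc scalerA big_seq big1 ?addr0 // => p'.
  rewrite in_fsetD1 => /andP[p'p p'x]; rewrite linearZ /= u0 ?scaler0 //.
  by rewrite -pn pmax.
have dU : mcoeff p x * c \is a GRing.unit.
  by rewrite unitrM cU fieldA // mcoeff_neq0.
have := Nlin (mcoeff p x * c)^-1 _ _ (Nact u _ xN) N0.
by rewrite addr0 E scalerA mulVr // scale1r.
Qed.

End FockRepresentation.

Lemma qF_unit : qF \is a GRing.unit.
Proof. by rewrite unitfE /qF tofrac_eq0 polyX_eq0. Qed.

Theorem theorem4p6 (R : realType) (K : set R)
  (hK : [\/ K = [set x : R | x \is a Num.int],
            K = range (@ratr R) | K = [set: R]]) :
  [/\ exists! act, fock_action (q := qL) (K := K) act,
      forall act, fock_action (q := qL) (K := K) act -> highest_weight act,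
      exists! act, fock_action (q := qF) (K := K) act
    & forall act, fock_action (q := qF) (K := K) act ->
        highest_weight act /\ irreducible act].
Proof.
split.
- exact/exists_unique_fock_action/qL_unit.
- move=> act /(fock_action_unique qL_unit) ->.
  exact: fock_act_highest_weight qL_unit.
- exact/exists_unique_fock_action/qF_unit.
- move=> act /(fock_action_unique qF_unit) ->; split.
    exact: fock_act_highest_weight qF_unit.
  have fieldQ (a : ratfrac) : a != 0 -> a \is a GRing.unit by rewrite unitfE.
  exact: (@fock_act_irreducible _ _ R K qF_unit fieldQ).
Qed.
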